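(* There exists a constant $A_2>0$, depending only on $d$, such that for all sufficiently small $r\in(0,1]$ (depending on $d$) and all $x\in\mathbb{R}^d$, $$\mu_r(x)\ \le\ A_2\,\delta_d(r)\,\|x\|_1 .$$
   Context: Frog model with Bernoulli initial configuration. Fix $d\ge2$ and $r\in(0,1]$. Let $\omega=(\omega(x))_{x\in\mathbb{Z}^d}$ be i.i.d. with $\mathbb{P}_r(\omega(x)=1)=1-\mathbb{P}_r(\omega(x)=0)=r$, and independently let $(S^x_k)_{k\ge0}$, $x\in\mathbb{Z}^d$, be independent simple random walks on $\mathbb{Z}^d$ with $S^x_0=x$; write $\mathbf P_r$ for the joint law. For $x,y\in\mathbb{Z}^d$ set $\tau(x,y):=\inf\{k\ge0:S^x_k=y\}$ if $\omega(x)=1$ and $\tau(x,y):=\infty$ if $\omega(x)=0$. The first passage time is $T(x,y):=\inf\{\sum_{i=0}^{m-1}\tau(x_i,x_{i+1}): m\in\mathbb{N},\ x_0,\dots,x_m\in\mathbb{Z}^d,\ x_0=x,\ x_m=y\}$. It is known that there is a deterministic norm $\mu_r$ on $\mathbb{R}^d$ (the time constant) such that $\mathbf P_r$-a.s. on $\{\omega(0)=1\}$, $\lim_{n\to\infty}T(0,nx)/n=\mu_r(x)$ for all $x\in\mathbb{Z}^d$. Define $\delta_d(r):=\sqrt{|\log r|/r}$ if $d=2$ and $\delta_d(r):=1/\sqrt r$ if $d\ge3$. $\|\cdot\|_1$ is the $\ell^1$-norm. *)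

(* Defs.v *)
From HB Require Import structures.
From mathcomp Require Import all_boot all_order all_algebra.
From mathcomp Require Import all_classical all_reals all_analysis.
Set Implicit Arguments. Unset Strict Implicit. Unset Printing Implicit Defensive.
Import Order.TTheory GRing.Theory Num.Theory.
Import numFieldNormedType.Exports.
Local Open Scope classical_set_scope.
Local Open Scope ring_scope.

Definition l1z (d : nat) (v : 'rV[int]_d) : int := \sum_(i < d) `|v ord0 i|.
Definition l1r (R : realType) (d : nat) (v : 'rV[R]_d) : R := \sum_(i < d) `|v ord0 i|.

Section Frog.
Variables (R : realType) (d : nat) (Omega : Type).
Variable (om : 'rV[int]_d -> Omega -> bool).
Variable (S : 'rV[int]_d -> nat -> Omega -> 'rV[int]_d).

(* inf {k >= 0 : S^x_k = y}, = +oo if the set is empty *)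
Definition hit_time (x y : 'rV[int]_d) (w : Omega) : \bar R :=
  ereal_inf [set ((k%:R)%:E : \bar R) | k in [set k : nat | S x k w = y]].

Definition tau (x y : 'rV[int]_d) (w : Omega) : \bar R :=
  if om x w then hit_time x y w else +oo%E.

Fixpoint path_cost (x : 'rV[int]_d) (p : seq 'rV[int]_d) (w : Omega) : \bar R :=
  match p with
  | [::] => 0%E
  | z :: p' => (tau x z w + path_cost z p' w)%E
  end.

Definition fpt (x y : 'rV[int]_d) (w : Omega) : \bar R :=
  ereal_inf [set path_cost x p w | p in [set p : seq 'rV[int]_d | last x p = y]].
End Frog.

Definition nn_path (d : nat) (s : nat -> 'rV[int]_d) (x : 'rV[int]_d) (n : nat) : bool :=
  (s 0%N == x) && [forall k : 'I_n, l1z (s k.+1 - s k) == 1].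

(* Joint law P_r: omega i.i.d. Bernoulli(r), independent of the independent
   simple random walks S^x with S^x_0 = x; characterized through all
   finite-dimensional cylinder probabilities. *)
Definition frog_law (R : realType) (d : nat) (dT : measure_display)
  (Omega : measurableType dT) (P : probability Omega R) (r : R)
  (om : 'rV[int]_d -> Omega -> bool) (S : 'rV[int]_d -> nat -> Omega -> 'rV[int]_d) : Prop :=
  (forall x b, measurable [set w | om x w = b]) /\
  (forall x k v, measurable [set w | S x k w = v]) /\
  (forall (F : seq 'rV[int]_d) (n : nat) (b : 'rV[int]_d -> bool)
          (s : 'rV[int]_d -> nat -> 'rV[int]_d), uniq F ->
     P (\bigcap_(x in [set` F])
          ([set w | om x w = b x] `&` \bigcap_(k in `I_n.+1) [set w | S x k w = s x k]))
     = (\prod_(x <- F) ((if b x then r else 1 - r) *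
                        (if nn_path (s x) x n then ((2 * d)%:R ^- n) else 0)))%:E).

Definition is_norm (R : realType) (d : nat) (mu : 'rV[R]_d -> R) : Prop :=
  (forall x y, mu (x + y) <= mu x + mu y) /\
  (forall (a : R) x, mu (a *: x) = `|a| * mu x) /\
  (forall x, mu x = 0 -> x = 0).

Definition time_constant (R : realType) (d : nat) (dT : measure_display)
  (Omega : measurableType dT) (P : probability Omega R)
  (om : 'rV[int]_d -> Omega -> bool) (S : 'rV[int]_d -> nat -> Omega -> 'rV[int]_d)
  (mu : 'rV[R]_d -> R) : Prop :=
  is_norm mu /\
  {ae P, forall w, om 0 w -> forall x : 'rV[int]_d,
     (fun n : nat => (fpt R om S 0 (x *+ n) w * ((n%:R)^-1)%:E)%E) @ \oo
       --> ((mu (map_mx (fun z : int => z%:~R) x))%:E : \bar R)}.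

Definition delta (R : realType) (d : nat) (r : R) : R :=
  if d == 2%N then Num.sqrt (`|ln r| / r) else (Num.sqrt r)^-1.

(* Main.v *)
Require Import Defs.
From HB Require Import structures.
From mathcomp Require Import all_boot all_order all_algebra.
From mathcomp Require Import all_classical all_reals all_analysis.
From mathcomp Require Import ring lra zify.
Import Order.TTheory GRing.Theory Num.Theory.
Set Implicit Arguments. Unset Strict Implicit. Unset Printing Implicit Defensive.
Local Open Scope ring_scope.

(* The norm [mu] is bounded through its values on the coordinate vectors, so it is enough
   to exhibit, for infinitely many [n], events of probability bounded below (for fixed [r])
   on which [om 0 w] and [T(0, n e_i) <= 2 rho n], where [rho] is of order [delta d r].

   Single leap. Write [G_T] for the expected number of returns to the origin up to time
   [T]. A walk started at distance of order [rho] from a cube of side [4 rho] visits,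
   with a probability depending only on [d], at least [c rho^2 / G_(rho^2)] sites of the
   cube before time [rho^2]: first and second moments of the number of visited sites
   (Paley-Zygmund) together with [P(S_k in cube) >= c] for [rho^2 / 2 <= k <= rho^2],
   which follows by tilting the walk. Since [G_T] is bounded for [d >= 3] and at most
   logarithmic for [d = 2], the choice of [rho] makes [r rho^2 / G_(rho^2)] large, so that
   [m] awake frogs wake up [4 m] frogs of the cube, except with a small probability.

   Crossing. A single frog per step dies out, so that crossings of length [8^k] are built
   recursively. Level [k + 1] consists of 8 segments; in each of them two disjoint lanes of
   level [k] are tried in parallel, and the frogs at the end of a successful lane are
   used to start the next two lanes. The failure probability satisfies
   [q' <= 8 (eps + q)^2 + eps] and stays below a fixed constant, while the leaps between
   the lanes of level [k], of duration [4^k rho^2], are negligible against [8^k rho^2].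

   End points. The frog at the origin starts a crossing of level [K] with one leap of scale
   [2^K rho]; at the end, leaps of decreasing scales lead to a cube of side [4 rho] next to
   [n e_i], which is then hit by one walk with a probability depending on [r] only. *)

(** * Simple random walks *)

Section WalkExpectation.
Variables (R : realType) (A : finType).
Implicit Types (q : A -> R) (f g : seq A -> R) (w : seq A).

(** The weights [q] are a parameter so that the simple walk and its tilted versions share one
    expectation. *)
Fixpoint walk_exp q (n : nat) f : R :=
  if n is n'.+1 then \sum_(s : A) q s * walk_exp q n' (fun w => f (s :: w))
  else f [::].

Lemma eq_walk_exp q n f g :
  (forall w, size w = n -> f w = g w) -> walk_exp q n f = walk_exp q n g.
Proof.
elim: n f g => [|n IH] f g fg /=; first exact: fg.
by apply: eq_bigr => s _; congr (_ * _); apply: IH => w sw; apply: fg; rewrite /= sw.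
Qed.

Lemma walk_expD q n f g :
  walk_exp q n (fun w => f w + g w) = walk_exp q n f + walk_exp q n g.
Proof.
elim: n f g => [|n IH] f g //=.
by rewrite -big_split; apply: eq_bigr => s _; rewrite IH mulrDr.
Qed.

Lemma walk_expZ q n c f : walk_exp q n (fun w => c * f w) = c * walk_exp q n f.
Proof.
elim: n f => [|n IH] f //=.
by rewrite big_distrr; apply: eq_bigr => s _; rewrite IH /= mulrCA.
Qed.

Lemma walk_exp_sum q n (I : Type) (r : seq I) (F : I -> seq A -> R) :
  walk_exp q n (fun w => \sum_(i <- r) F i w) = \sum_(i <- r) walk_exp q n (F i).
Proof.
elim: r => [|i r IH].
  rewrite big_nil (@eq_walk_exp _ _ _ (fun w => 0 * 0)); last first.
    by move=> w _; rewrite big_nil mul0r.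
  by rewrite (walk_expZ q n 0 (fun=> 0)) mul0r.
rewrite big_cons -IH -walk_expD; apply: eq_walk_exp => w _.
by rewrite big_cons.
Qed.

Variable q : A -> R.
Hypothesis q_ge0 : forall s, 0 <= q s.

Lemma le_walk_exp n f g :
  (forall w, size w = n -> f w <= g w) -> walk_exp q n f <= walk_exp q n g.
Proof.
elim: n f g => [|n IH] f g fg /=; first exact: fg.
apply: ler_sum => s _; apply: ler_wpM2l; first exact: q_ge0.
by apply: IH => w sw; apply: fg; rewrite /= sw.
Qed.

Hypothesis q_sum1 : \sum_s q s = 1.

Lemma walk_exp_cst n c : walk_exp q n (fun=> c) = c.
Proof.
by elim: n => [|n IH] //=; under eq_bigr do rewrite IH; rewrite -mulr_suml q_sum1 mul1r.
Qed.

Lemma walk_exp_ge0 n f : (forall w, size w = n -> 0 <= f w) -> 0 <= walk_exp q n f.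
Proof.
by move=> f0; rewrite -{1}(walk_exp_cst n 0); apply: le_walk_exp.
Qed.

Lemma walk_exp_le_cst n f c :
  (forall w, size w = n -> f w <= c) -> walk_exp q n f <= c.
Proof.
by move=> fc; rewrite -[leRHS](walk_exp_cst n); apply: le_walk_exp.
Qed.

(** The steps after time [m] integrate to one. All walks can thus be revealed up to one common
    horizon and used only up to a shorter time. *)
Lemma walk_exp_take m n f : (m <= n)%N ->
  walk_exp q n (fun w => f (take m w)) = walk_exp q m f.
Proof.
elim: m n f => [|m IH] n f mn.
  under eq_walk_exp do rewrite take0.
  by rewrite walk_exp_cst.
case: n mn => [//|n] mn /=.
by apply: eq_bigr => s _; rewrite -(IH n (fun w => f (s :: w))).
Qed.

End WalkExpectation.

(** * Visits, hitting probabilities and range of the simple random walk *)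

Section Walks.
Variables (R : realType) (d : nat).
Local Notation site := 'rV[int]_d.
Local Notation step := ('I_d * bool)%type.
Implicit Types (x y v : site) (w : seq step) (V : seq site).

Definition step_vec (s : step) : site :=
  if s.2 then delta_mx ord0 s.1 else - delta_mx ord0 s.1.

Fixpoint traj x w : seq site :=
  x :: (if w is s :: w' then traj (x + step_vec s) w' else [::]).

Fixpoint pos x w : site :=
  if w is s :: w' then pos (x + step_vec s) w' else x.

Lemma size_traj x w : size (traj x w) = (size w).+1.
Proof. by elim: w x => //= s w IH x; rewrite IH. Qed.

Lemma mem_traj0 x w : x \in traj x w.
Proof. by case: w => [|s w]; rewrite /= inE eqxx. Qed.

Lemma nth_traj x w k : (k <= size w)%N -> nth 0 (traj x w) k = pos x (take k w).
Proof.
elim: w x k => [|s w IH] x [|k] //= kw; exact: IH.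
Qed.

Lemma mem_trajP x w y :
  reflect (exists2 k, (k <= size w)%N & pos x (take k w) = y) (y \in traj x w).
Proof.
apply: (iffP (nthP 0)) => [[k]|[k]].
  by rewrite size_traj ltnS => kw <-; exists k => //; rewrite nth_traj.
by move=> kw <-; exists k; [rewrite size_traj ltnS | rewrite nth_traj].
Qed.

Lemma traj_shift x y w : traj (x + y) w = [seq z + y | z <- traj x w].
Proof.
by elim: w x => [|s w IH] x //=; rewrite -IH addrAC.
Qed.

Lemma pos_sum x w : pos x w = x + \sum_(s <- w) step_vec s.
Proof.
elim: w x => [|s w IH] x /=; first by rewrite big_nil addr0.
by rewrite IH big_cons addrA.
Qed.

Definition srw : step -> R := fun=> ((2 * d)%:R)^-1.

Local Notation walkE := (walk_exp srw).

Lemma srw_ge0 s : 0 <= srw s.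
Proof. by rewrite invr_ge0 ler0n. Qed.

Hypothesis d_gt0 : (0 < d)%N.

Lemma srw_sum1 : \sum_s srw s = 1.
Proof.
rewrite sumr_const card_prod card_ord card_bool mulnC -[LHS]mulr_natl divff //.
by rewrite pnatr_eq0; lia.
Qed.

Definition visits y x w : R := (count_mem y (traj x w))%:R.
Definition hits y x w : R := (y \in traj x w)%:R.
Definition green n : R := walkE n (visits 0 0).

Lemma visits_cons y x s w :
  visits y x (s :: w) = (x == y)%:R + visits y (x + step_vec s) w.
Proof. by rewrite /visits /= natrD. Qed.

Lemma hits_cons y x s w : x != y -> hits y x (s :: w) = hits y (x + step_vec s) w.
Proof. by move=> xy; rewrite /hits /= inE eq_sym (negPf xy). Qed.

Lemma walkE_visits_diag n y : walkE n (visits y y) = green n.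
Proof.
apply: eq_walk_exp => w _; rewrite /visits -[in traj y w](add0r y) traj_shift.
rewrite count_map; congr (_%:R); apply: eq_count => z /=.
by rewrite -subr_eq0 addrK.
Qed.

Lemma walkE_visits_le m n y x : (m <= n)%N ->
  walkE m (visits y x) <= walkE n (visits y x).
Proof.
move=> mn; rewrite -(walk_exp_take srw_sum1 _ mn); apply: le_walk_exp => [|w wn].
  exact: srw_ge0.
rewrite /visits ler_nat; apply: leq_count_subseq.
rewrite -[in X in subseq _ X](cat_take_drop m w).
elim: (take m w) x => [|s u IH] x /=; last by rewrite eqxx IH.
by case: (drop m w) => [|s u] /=; rewrite eqxx ?sub0seq.
Qed.

Lemma green_le m n : (m <= n)%N -> green m <= green n.
Proof. exact: walkE_visits_le. Qed.

Lemma green_ge1 n : 1 <= green n.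
Proof.
rewrite -[leLHS](walk_exp_cst srw_sum1 n); apply: le_walk_exp; first exact: srw_ge0.
move=> w _; rewrite /visits ler1n -has_count.
by apply/hasP; exists 0 => /=; [exact: mem_traj0 | rewrite eqxx].
Qed.

Lemma green_gt0 n : 0 < green n.
Proof. exact: lt_le_trans (green_ge1 n). Qed.

Lemma walkE_hits_ge0 n y x : 0 <= walkE n (hits y x).
Proof.
by apply: walk_exp_ge0; [exact: srw_ge0 | exact: srw_sum1 | move=> w _; exact: ler0n].
Qed.

Lemma walkE_visitsS n y x :
  walkE n.+1 (visits y x)
  = (x == y)%:R + \sum_s srw s * walkE n (visits y (x + step_vec s)).
Proof.
rewrite /=; under eq_bigr => s _.
  under eq_walk_exp do rewrite visits_cons.
  rewrite (walk_expD srw n (fun=> (x == y)%:R)) (walk_exp_cst srw_sum1) mulrDr.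
  over.
by rewrite big_split /= -mulr_suml srw_sum1 mul1r.
Qed.

Lemma walkE_hitsS n y x : x != y ->
  walkE n.+1 (hits y x) = \sum_s srw s * walkE n (hits y (x + step_vec s)).
Proof.
move=> xy; rewrite /=; apply: eq_bigr => s _; congr (_ * _).
by apply: eq_walk_exp => w _; rewrite hits_cons.
Qed.

Lemma walkE_hits_diag n y : walkE n (hits y y) = 1.
Proof.
rewrite -(walk_exp_cst srw_sum1 n 1); apply: eq_walk_exp => w _.
by rewrite /hits mem_traj0.
Qed.

Lemma hits0 y x : x != y -> walkE 0 (hits y x) = 0.
Proof. by move=> xy; rewrite /= /hits /= inE eq_sym (negPf xy). Qed.

(* Both bounds decompose at the first visit to [y]. *)
Lemma visits_le_hits n y x :
  walkE n (visits y x) <= walkE n (hits y x) * green n.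
Proof.
elim: n x => [|n IH] x; have [<-|xy] := eqVneq x y.
- by rewrite walkE_hits_diag mul1r walkE_visits_diag.
- by rewrite hits0 // mul0r /visits /= (negPf xy).
- by rewrite walkE_hits_diag mul1r walkE_visits_diag.
rewrite walkE_visitsS walkE_hitsS // (negPf xy) add0r mulr_suml.
apply: ler_sum => s _; rewrite -mulrA; apply: ler_wpM2l; first exact: srw_ge0.
apply: le_trans (IH _) _; apply: ler_wpM2l; first exact: walkE_hits_ge0.
exact: green_le.
Qed.

Lemma hits_le_visits m n y x :
  walkE n (hits y x) * green m <= walkE (n + m) (visits y x).
Proof.
elim: n x => [|n IH] x; have [<-|xy] := eqVneq x y.
- by rewrite walkE_hits_diag mul1r walkE_visits_diag.
- rewrite hits0 // mul0r; apply: walk_exp_ge0; [exact: srw_ge0|exact: srw_sum1|].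
  by move=> w _; exact: ler0n.
- by rewrite walkE_hits_diag mul1r walkE_visits_diag; apply: green_le; rewrite leq_addl.
rewrite addSn walkE_visitsS walkE_hitsS // (negPf xy) add0r mulr_suml.
by apply: ler_sum => s _; rewrite -mulrA; apply: ler_wpM2l; [exact: srw_ge0|exact: IH].
Qed.

Lemma sum_visits_le (V : seq site) x w : uniq V ->
  \sum_(v <- V) visits v x w <= (size w).+1%:R.
Proof.
move=> uV; rewrite -(size_traj x w) -natr_sum ler_nat.
elim: (traj x w) => [|a s IH] /=; first by rewrite big1.
rewrite big_split /= -[(size s).+1]add1n leq_add //.
rewrite (eq_bigr (fun v => if v == a then 1%N else 0%N)); last first.
  by move=> v _; rewrite eq_sym; case: eqP.
by rewrite -big_mkcond /= sum1_count count_uniq_mem // leq_b1.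
Qed.

(** An upper bound for the mean number of distinct sites visited in [n] steps: each site hit by time
    [n] is visited [green n] times on average within the next [n] steps, and there are [2 n + 1]
    times up to [2 n]. *)
Definition max_range n : R := (2 * n).+1%:R / green n.

Lemma sum_hits_le n x (V : seq site) : uniq V ->
  \sum_(v <- V) walkE n (hits v x) <= max_range n.
Proof.
move=> uV; rewrite ler_pdivlMr ?green_gt0 // mulr_suml.
apply: (@le_trans _ _ (\sum_(v <- V) walkE (n + n) (visits v x))).
  by apply: ler_sum => v _; exact: hits_le_visits.
rewrite -walk_exp_sum.
apply: walk_exp_le_cst; [exact: srw_ge0|exact: srw_sum1|move=> w wn].
by apply: le_trans (sum_visits_le _ _ uV) _; rewrite wn addnn -mul2n.
Qed.

Lemma max_range_gt0 n : 0 < max_range n.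
Proof. by rewrite divr_gt0 ?green_gt0. Qed.

(** This is the trajectory from the first visit to [y] on, to which the strong Markov property
    applies. *)
Fixpoint after y x w : seq site :=
  if x == y then traj x w else if w is s :: w' then after y (x + step_vec s) w' else [::].

Lemma mem_traj_after y y' x w : y \in traj x w -> y' \in traj x w ->
  (y' \in after y x w) || (y \in after y' x w).
Proof.
elim: w x => [|s w IH] x /=.
  by rewrite !inE => /eqP<- /eqP<-; rewrite !eqxx inE eqxx.
move=> hy hy'; case: (eqVneq x y) => [xy|xy]; first by rewrite hy'.
case: (eqVneq x y') => [xy'|xy']; first by rewrite hy orbT.
apply: IH; first by move: hy; rewrite inE eq_sym (negPf xy).
by move: hy'; rewrite inE eq_sym (negPf xy').
Qed.

(** Strong Markov property at the first visit to [y], followed by the bound on the range of the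
    remaining walk. The horizon [N] of that bound stays fixed, since the number of remaining steps
    varies in the induction. *)
Lemma sum_after_le N n y x (V : seq site) : uniq V -> (n <= N)%N ->
  \sum_(v <- V) walkE n (fun w => (v \in after y x w)%:R)
    <= walkE n (hits y x) * max_range N.
Proof.
move=> uV; elim: n x => [|n IH] x nN; have [<-|xy] := eqVneq x y.
- rewrite walkE_hits_diag mul1r; apply: le_trans (sum_hits_le N x uV).
  apply: ler_sum => v _; rewrite /= eqxx ?inE.
  have [->|vx] := eqVneq v x; last exact: walkE_hits_ge0.
  by rewrite -[leRHS]/(walkE N (hits x x)) walkE_hits_diag.
- by rewrite hits0 // mul0r big1 // => v _; rewrite /= (negPf xy).
- rewrite walkE_hits_diag mul1r; apply: le_trans (sum_hits_le N x uV).
  (* The horizon is extended to [N]: a longer walk visits at least the same sites. *)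
  apply: ler_sum => v _; rewrite -(walk_exp_take srw_sum1 _ nN).
  apply: le_walk_exp => [|w wn]; first exact: srw_ge0.
  rewrite /hits ler_nat; case: w wn => [|s w] //= wn.
    by rewrite -wn in nN.
  rewrite eqxx !inE; case: (v == x) => //=; apply: 
    (@leq_trans (v \in traj (x + step_vec s) (take n w))).
    by [].
  have sub : {subset traj (x + step_vec s) (take n w) <= traj (x + step_vec s) w}.
    move=> u /mem_trajP[k kw <-]; apply/mem_trajP; exists k.
      by apply: leq_trans kw _; rewrite size_take_min geq_minr.
    by rewrite take_takel //; apply: leq_trans kw _; rewrite size_take_min geq_minl.
  by case: (boolP (v \in traj _ (take n w))) => // /sub ->.
rewrite walkE_hitsS // mulr_suml /= (eq_bigr (fun v => \sum_s srw s *
   walkE n (fun w => (v \in after y (x + step_vec s) w)%:R))); last first.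
  by move=> v _; apply: eq_bigr => s _; rewrite (negPf xy).
rewrite exchange_big; apply: ler_sum => s _.
rewrite -mulr_sumr -mulrA; apply: ler_wpM2l; first exact: srw_ge0.
by apply: IH; exact: ltnW.
Qed.

Definition nvisited (V : seq site) x w : R := \sum_(v <- V) hits v x w.

Lemma walkE_nvisited n V x : walkE n (nvisited V x) = \sum_(v <- V) walkE n (hits v x).
Proof. by rewrite /nvisited walk_exp_sum. Qed.

(** Of two visited sites, one is visited after the first visit to the other. Pairs therefore cost
    one more factor [max_range n], and the 2 accounts for the order. *)
Lemma nvisited_sqr_le n V x : uniq V ->
  walkE n (fun w => nvisited V x w ^+ 2)
    <= 2 * max_range n * walkE n (nvisited V x).
Proof.
move=> uV.
apply: (@le_trans _ _ (walkE n (fun w =>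
   \sum_(v <- V) \sum_(v' <- V) ((v' \in after v x w)%:R + (v \in after v' x w)%:R)))).
  apply: le_walk_exp => [|w _]; first exact: srw_ge0.
  rewrite expr2 /nvisited mulr_suml; apply: ler_sum => v _; rewrite mulr_sumr.
  apply: ler_sum => v' _; rewrite -natrM -natrD ler_nat.
  have := @mem_traj_after v v' x w.
  by case: (v \in traj x w); case: (v' \in traj x w);
     case: (v' \in after v x w); case: (v \in after v' x w) => // /(_ isT isT).
rewrite walk_exp_sum.
under eq_bigr => v _.
  rewrite walk_exp_sum; under eq_bigr do rewrite walk_expD; rewrite big_split /=; over.
rewrite big_split /= [X in _ + X]exchange_big /= -mulr2n -[leLHS]mulr_natl -mulrA.
apply: ler_wpM2l => //; rewrite walkE_nvisited mulrC mulr_suml.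
by apply: ler_sum => v _; exact: sum_after_le.
Qed.

(* Paley-Zygmund, written with the linearisation
   [W 1_A <= W^2 / (8 M) + 2 M 1_A] to avoid square roots. *)
Lemma nvisited_paley_zygmund n V x (a : R) : uniq V -> 0 < a ->
  a <= walkE n (nvisited V x) ->
  a / (8 * max_range n) <= walkE n (fun w => ((a / 2 <= nvisited V x w)%R)%:R).
Proof.
move=> uV a0 aE; have M0 := max_range_gt0 n.
set M := max_range n in M0 *; set E := walkE n (nvisited V x) in aE.
set pr := walkE n _.
have W2 := @nvisited_sqr_le n V x uV; rewrite -/M -/E in W2.
have key : E <= a / 2 + ((8 * M)^-1 * walkE n (fun w => nvisited V x w ^+ 2) + 2 * M * pr).
  rewrite -[in leRHS](walk_exp_cst srw_sum1 n (a / 2)) /pr.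
  rewrite -!walk_expZ -!walk_expD; apply: le_walk_exp => [|w _]; first exact: srw_ge0.
  have W0 : 0 <= nvisited V x w by apply: sumr_ge0 => v _; exact: ler0n.
  move: (nvisited V x w) W0 => W W0.
  have sq : 0 <= (8 * M)^-1 * W ^+ 2 by apply: mulr_ge0; rewrite ?sqr_ge0 // invr_ge0; lra.
  case: (leP (a / 2) W) => [_|Wa]; last by rewrite mulr0 addr0; lra.
  suff : W <= (8 * M)^-1 * W ^+ 2 + 2 * M by rewrite mulr1; lra.
  (* Completing the square at [W = 4 M]. *)
  have -> : (8 * M)^-1 * W ^+ 2 + 2 * M = ((W - 4 * M) ^+ 2) / (8 * M) + W.
    by field; rewrite ?gt_eqF.
  by rewrite lerDr divr_ge0 ?sqr_ge0 //; lra.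
(* The second moment term is at most [E / 4], so that [2 M pr >= 3 E / 4 - a / 2 >= a / 4]. *)
have h : (8 * M)^-1 * walkE n (fun w => nvisited V x w ^+ 2) <= E / 4.
  rewrite mulrC ler_pdivrMr; last by lra.
  by apply: le_trans W2 _; lra.
rewrite ler_pdivrMr; last by lra.
nra.
Qed.

End Walks.

(** * Tilting of the walk *)

Section Tilt.
Variables (R : realType) (d : nat).
Local Notation site := 'rV[int]_d.
Local Notation step := ('I_d * bool)%type.
Local Notation walkE := (walk_exp (@srw R d)).
Hypothesis d_gt0 : (0 < d)%N.

Definition coord (x : site) i : R := (x ord0 i)%:~R.

Definition cube (z : site) (l : nat) (x : site) : bool :=
  [forall i, (z ord0 i <= x ord0 i) && (x ord0 i < z ord0 i + l%:Z)].

Definition sgb (b : bool) : R := if b then 1 else -1.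

Lemma coord_step x s i : coord (x + step_vec s) i = coord x i + (i == s.1)%:R * sgb s.2.
Proof.
rewrite /coord /step_vec /sgb; case: s => j [] /=; rewrite !mxE eqxx /= rmorphD.
  by rewrite mulr1; case: (i == j).
by rewrite mulrN1 rmorphN; case: (i == j).
Qed.

Lemma sum_step (F : step -> R) : \sum_s F s = \sum_i (F (i, true) + F (i, false)).
Proof.
rewrite (eq_bigr (fun s => F (s.1, s.2))); last by move=> [].
rewrite -(pair_bigA _ (fun i b => F (i, b))) /=; apply: eq_bigr => i _.
by rewrite big_bool.
Qed.

Variable beta : 'I_d -> R.
Hypothesis beta_le1 : forall i, `|beta i| <= 1.

(** The drift per step is [beta i / d] in direction [i]. Linear weights need no normalising
    constant, and [1 + u <= expR u] compares them with exponential ones. *)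
Definition tilt (s : step) : R := (1 + sgb s.2 * beta s.1) / (2 * d)%:R.

Lemma tilt_ge0 s : 0 <= tilt s.
Proof.
rewrite /tilt divr_ge0 ?ler0n //; have := beta_le1 s.1; rewrite ler_norml /sgb.
by case: s.2 => /andP[]; lra.
Qed.

Lemma tilt_sum1 : \sum_s tilt s = 1.
Proof.
rewrite sum_step -(srw_sum1 R d_gt0) sum_step; apply: eq_bigr => i _.
by rewrite /tilt /srw /sgb /=; field; rewrite pnatr_eq0; lia.
Qed.

Lemma tilt_le_srw s : tilt s <= srw R s * expR (beta s.1 * sgb s.2).
Proof.
rewrite /tilt /srw mulrC; apply: ler_wpM2l; first by rewrite invr_ge0 ler0n.
by rewrite mulrC; exact: expR_ge1Dx.
Qed.

(** Steps have length one, so each contributes at most one to the variance. The free centre [u]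
    absorbs the drift of the first step in the induction. *)
Lemma tilt_variance n x (u : 'I_d -> R) :
  walk_exp tilt n (fun w => \sum_i (coord (pos x w) i - u i - n%:R * (beta i / d%:R)) ^+ 2)
    <= \sum_i (coord x i - u i) ^+ 2 + n%:R.
Proof.
elim: n x u => [|n IH] x u /=.
  by rewrite addr0; apply: ler_sum => i _; rewrite mul0r subr0.
pose u' i := u i + beta i / d%:R.
apply: (@le_trans _ _ (\sum_s tilt s * (\sum_i (coord (x + step_vec s) i - u' i) ^+ 2 + n%:R))).
  apply: ler_sum => s _; apply: ler_wpM2l; first exact: tilt_ge0.
  apply: le_trans (IH _ _); apply: le_walk_exp => [|w _]; first exact: tilt_ge0.
  apply: ler_sum => i _; rewrite le_eqVlt; apply/orP; left; apply/eqP.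
  by rewrite /u' -natr1; ring.
rewrite [leLHS](eq_bigr (fun s => tilt s * (\sum_i (coord (x + step_vec s) i - u' i) ^+ 2) +
    tilt s * n%:R)); last by move=> s _; rewrite mulrDr.
rewrite big_split /= -mulr_suml tilt_sum1 mul1r -natr1 [n%:R + 1]addrC addrA lerD2r.
pose D i := coord x i - u i; pose b i := beta i / d%:R.
have -> : \sum_s tilt s * (\sum_i (coord (x + step_vec s) i - u' i) ^+ 2) =
   \sum_s (tilt s * (\sum_i (D i - b i) ^+ 2 + 1) + tilt s * (2 * sgb s.2 * (D s.1 - b s.1))).
  apply: eq_bigr => s _; rewrite -mulrDr; congr (_ * _).
  rewrite (bigD1 s.1) //= [in RHS](bigD1 s.1) //= coord_step eqxx mul1r.
  rewrite (eq_bigr (fun i => (D i - b i) ^+ 2)); last first.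
    move=> i /negPf ns; rewrite coord_step ns mul0r /D /b /u'; congr (_ ^+ 2).
    by ring.
  rewrite /D /b /u' /sgb; case: s.2; ring.
rewrite big_split /= -mulr_suml tilt_sum1 mul1r sum_step.
rewrite [X in _ + X <= _](eq_bigr (fun i => 2 * b i * (D i - b i))); last first.
  move=> i _; rewrite /tilt /sgb /b /= natrM; field.
  by rewrite pnatr_eq0; lia.
rewrite addrAC lerD2r -big_split /=; apply: ler_sum => i _.
rewrite -/(D i); have := sqr_ge0 (b i); nra.
Qed.

(** The likelihood ratio is a product of factors [1 + sgb s.2 * beta s.1], each at most an
    exponential; the exponents add up to the scalar product of [beta] with the displacement. *)
Lemma walk_exp_tilt_le n x (f : seq step -> R) : (forall w, 0 <= f w) ->
  walk_exp tilt n f <=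
  walkE n (fun w => expR (\sum_i beta i * (coord (pos x w) i - coord x i)) * f w).
Proof.
elim: n x f => [|n IH] x f f0 /=.
  rewrite big1; first by rewrite expR0 mul1r.
  by move=> i _; rewrite subrr mulr0.
apply: ler_sum => s _.
apply: (@le_trans _ _ (tilt s * walkE n (fun w =>
   expR (\sum_i beta i * (coord (pos (x + step_vec s) w) i - coord (x + step_vec s) i))
   * f (s :: w)))).
  by apply: ler_wpM2l; [exact: tilt_ge0 | apply: IH].
set F := walkE n _.
have F0 : 0 <= F.
  apply: walk_exp_ge0; [exact: srw_ge0|exact: srw_sum1|move=> w _].
  by rewrite mulr_ge0 ?expR_ge0.
apply: (le_trans (ler_wpM2r F0 (tilt_le_srw s))).
rewrite -mulrA; apply: ler_wpM2l; first exact: srw_ge0.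
rewrite -walk_expZ; apply: le_walk_exp => [|w _]; first exact: srw_ge0.
rewrite mulrA; apply: ler_wpM2r => //; rewrite -expRD ler_expR.
rewrite (bigD1 s.1) //= [leRHS](bigD1 s.1) //= coord_step eqxx mul1r.
rewrite addrA lerD //; first by rewrite le_eqVlt; apply/orP; left; apply/eqP; ring.
apply: ler_sum => i /negPf ns.
by rewrite coord_step ns mul0r addr0.
Qed.

End Tilt.

(** * Probability of being in a given cube *)

Section WalkInCube.
Variables (R : realType) (d : nat).
Local Notation site := 'rV[int]_d.
Local Notation step := ('I_d * bool)%type.
Local Notation walkE := (walk_exp (@srw R d)).
Hypothesis d_gt0 : (0 < d)%N.

(** The constant 12 is 8 + 4: the crossings start walks up to two cube sides, that is [8 rho], in
    front of the cube of side [4 rho] that they aim at. *)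
Definition near_cube (rho : nat) (x z : site) := forall i,
  x ord0 i - 12 * rho%:Z <= z ord0 i /\ z ord0 i + 4 * rho%:Z <= x ord0 i + 12 * rho%:Z.

Definition cube_prob : R := 3 / 4 * expR (- (240 * d%:R ^+ 2)).

Lemma cube_prob_gt0 : 0 < cube_prob.
Proof. by rewrite mulr_gt0 ?expR_gt0 //; lra. Qed.

(* The walk is tilted so that its mean at time [k] is the centre of the cube;
   the density of the tilted law is bounded on the cube. *)
Lemma walk_in_cube rho k x z : (20 * d <= rho)%N -> near_cube rho x z ->
  (rho ^ 2 <= 2 * k)%N -> (k <= rho ^ 2)%N ->
  cube_prob <= walkE k (fun w => (cube z (4 * rho) (pos x w))%:R).
Proof.
move=> drho near k1 k2.
have rho0 : (0 < rho)%N by lia.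
have k0 : (0 < k)%N by nia.
(* [u] is the displacement from [x] to the centre of the cube, and [beta] makes the mean
   displacement at time [k] equal to [u]. *)
pose u i := coord R z i + 2 * rho%:R - coord R x i.
pose beta i := d%:R * u i / k%:R.
have dR : 0 < d%:R :> R by rewrite ltr0n.
have kR : 0 < k%:R :> R by rewrite ltr0n.
have rhoR : 0 < rho%:R :> R by rewrite ltr0n.
have drhoR : 20 * d%:R <= rho%:R :> R by rewrite -natrM ler_nat.
have k1R : rho%:R ^+ 2 <= 2 * k%:R :> R by rewrite -natrX -natrM ler_nat.
have k2R : k%:R <= rho%:R ^+ 2 :> R by rewrite -natrX ler_nat.
have uB i : `|u i| <= 10 * rho%:R.
  have [] := near i; rewrite -!(ler_int R) !rmorphB !rmorphD !rmorphM /=.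
  rewrite -/(coord R x i) -/(coord R z i) !mulrz_nat !pmulrn /= => h1 h2.
  by rewrite ler_norml /u; apply/andP; split; lra.
have betaB i : `|beta i| <= 20 * d%:R / rho%:R.
  rewrite /beta !normrM normrV ?unitfE ?gt_eqF // (ger0_norm (ltW dR)) (ger0_norm (ltW kR)).
  have h : `|u i| * rho%:R <= 20 * k%:R by have := uB i; nra.
  rewrite ler_pdivrMr // mulrAC ler_pdivlMr // -mulrA [20 * _]mulrC -mulrA.
  by apply: ler_wpM2l; [exact: ltW | lra].
have beta1 i : `|beta i| <= 1.
  by apply: le_trans (betaB i) _; rewrite ler_pdivrMr ?mul1r.
set f : seq step -> R := fun w => (cube z (4 * rho) (pos x w))%:R.
(* Chebyshev: outside the cube some coordinate is at least [2 rho] away from the centre, whereas the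
   total variance is at most [k <= rho^2]. *)
have lower : 3 / 4 <= walk_exp (tilt beta) k f.
  have := @tilt_variance _ _ d_gt0 _ beta1 k x (coord R x).
  rewrite [X in _ <= X + _]big1; last by move=> i _; rewrite subrr expr0n.
  rewrite add0r => var.
  have r4 : 0 < 4 * rho%:R ^+ 2 :> R by rewrite mulr_gt0 ?exprn_gt0.
  have inv0 : 0 <= (4 * rho%:R ^+ 2)^-1 :> R by rewrite invr_ge0 ltW.
  have : walk_exp (tilt beta) k (fun w => 1 + - (4 * rho%:R ^+ 2)^-1 *
     \sum_i (coord R (pos x w) i - coord R x i - k%:R * (beta i / d%:R)) ^+ 2)
     <= walk_exp (tilt beta) k f.
    apply: le_walk_exp => [|w _]; first exact: tilt_ge0.
    rewrite /f; case: (boolP (cube _ _ _)) => [_|].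
      rewrite gerDl mulNr oppr_le0 mulr_ge0 ?inv0 //.
      by apply: sumr_ge0 => i _; exact: sqr_ge0.
    rewrite negb_forall => /existsP[i ni].
    rewrite mulNr subr_le0 ler_pdivlMl //.
    rewrite mulr1 (bigD1 i) //=; apply: ler_wpDr.
      by apply: sumr_ge0 => j _; exact: sqr_ge0.
    have -> : coord R (pos x w) i - coord R x i - k%:R * (beta i / d%:R)
      = coord R (pos x w) i - coord R z i - 2 * rho%:R.
      by rewrite /beta /u; field; rewrite !gt_eqF.
    move: ni; rewrite negb_and -!ltNge -leNgt.
    rewrite -(ltr_int R) -(ler_int R) rmorphD /= -/(coord R (pos x w) i) -/(coord R z i).
    rewrite -pmulrn natrM => /orP[h|h]; nra.
  rewrite walk_expD walk_exp_cst ?tilt_sum1 // walk_expZ.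
  apply: le_trans.
  have : (4 * rho%:R ^+ 2)^-1 * walk_exp (tilt beta) k (fun w => 
     \sum_i (coord R (pos x w) i - coord R x i - k%:R * (beta i / d%:R)) ^+ 2) <= 1 / 4.
    rewrite ler_pdivrMl //.
    by apply: le_trans var _; nra.
  lra.
have f0 w : 0 <= f w by exact: ler0n.
have := le_trans lower (walk_exp_tilt_le d_gt0 beta1 k x f0).
pose C : R := 240 * d%:R ^+ 2.
have : walkE k (fun w => expR (\sum_i beta i * (coord R (pos x w) i - coord R x i)) * f w)
    <= walkE k (fun w => expR C * f w).
  apply: le_walk_exp => [|w _]; first exact: srw_ge0.
  rewrite /f; case: (boolP (cube _ _ _)) => [/forallP cw|]; last by rewrite !mulr0.
  rewrite !mulr1 ler_expR.
  (* On the cube each coordinate has moved by at most [12 rho], and [|beta i| <= 20 d / rho];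
     summing over [i] gives the exponent [240 d^2] of [cube_prob]. *)
  apply: (@le_trans _ _ (\sum_(i < d) (240 * d%:R))); last first.
    by rewrite sumr_const card_ord -[leLHS]mulr_natl /C; nra.
  apply: ler_sum => i _; apply: le_trans (ler_norm _) _; rewrite normrM.
  apply: (@le_trans _ _ ((20 * d%:R / rho%:R) * (12 * rho%:R))); last first.
    by rewrite le_eqVlt; apply/orP; left; apply/eqP; field; rewrite gt_eqF.
  apply: ler_pM => //.
  have /andP[] := cw i; have [] := near i.
  rewrite -!(ler_int R) -!(ltr_int R) !rmorphB !rmorphD !rmorphM /=.
  rewrite -/(coord R x i) -/(coord R z i) -/(coord R (pos x w) i) => h1 h2 h3 h4.
  rewrite ler_norml; apply/andP; split; move: h1 h2 h3 h4; rewrite -?pmulrn ?natrM; lra.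
rewrite walk_expZ /cube_prob expRN -/C => h1 h2.
have e0 := expR_gt0 C.
rewrite ler_pdivrMr //; lra.
Qed.

End WalkInCube.

(** * Number of sites of a cube visited by one walk *)

Section CubeVisits.
Variables (R : realType) (d : nat).
Local Notation site := 'rV[int]_d.
Local Notation step := ('I_d * bool)%type.
Local Notation walkE := (walk_exp (@srw R d)).
Hypothesis d_gt0 : (0 < d)%N.
Implicit Types (V : seq site) (x z : site) (w : seq step).

Definition cube_seq (z : site) (l : nat) : seq site :=
  [seq (\row_i (z ord0 i + (f i)%:Z))%R | f : {ffun 'I_d -> 'I_l}].

Lemma cube_seq_uniq z l : uniq (cube_seq z l).
Proof.
rewrite map_inj_uniq ?enum_uniq // => f g /rowP fg; apply/ffunP => i.
by have := fg i; rewrite !mxE => /addrI[] /val_inj.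
Qed.

Lemma mem_cube_seq z l x : (x \in cube_seq z l) = cube z l x.
Proof.
clear d_gt0; apply/idP/forallP => [/mapP[f _ ->] i|cx].
  by rewrite mxE lerDl ltrD2l ltz_nat ltn_ord.
have lt i : (`|x ord0 i - z ord0 i| < l)%N.
  by move: (cx i); move: (x ord0 i) (z ord0 i) => a b /andP[]; lia.
apply/mapP; exists [ffun i => Ordinal (lt i)]; first by rewrite mem_enum.
by apply/rowP => i; rewrite !mxE ffunE /=;
  move: (cx i); move: (x ord0 i) (z ord0 i) => a b /andP[]; lia.
Qed.

Lemma sum_visits_time (V : seq site) x w : uniq V ->
  \sum_(v <- V) visits R v x w = \sum_(k < (size w).+1) (pos x (take k w) \in V)%:R.
Proof.
move=> uV; transitivity ((\sum_(y <- traj x w) (y \in V)%:R) : R).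
  rewrite /visits; elim: (traj x w) => [|a s IH] /=; first by rewrite big_nil big1.
  under eq_bigr do rewrite natrD.
  rewrite big_split /= IH big_cons; congr (_ + _).
  rewrite -natr_sum -(count_uniq_mem _ uV) -sum1_count [in RHS]big_mkcond /=.
  by congr (_%:R); apply: eq_bigr => v _; rewrite eq_sym; case: eqP.
elim: w x => [|s w IH] x /=; first by rewrite big_seq1 big_ord1.
by rewrite big_cons big_ord_recl /= IH.
Qed.

(** Pairing [k] with [T - k]: one of the two is at least [T / 2]. *)
Lemma half_times (T : nat) : T%:R / 2 <= \sum_(k < T.+1) (T <= 2 * k)%:R :> R.
Proof.
clear d_gt0; rewrite ler_pdivrMr // mulr_natr mulr2n.
rewrite [X in _ <= _ + X](reindex_inj rev_ord_inj) /= -big_split /=.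
apply: (@le_trans _ _ (\sum_(k < T.+1) 1)).
  by rewrite sumr_const card_ord -[T.+1]addn1 mulrnDr lerDl.
apply: ler_sum => k _; rewrite -natrD ler1n; have := ltn_ord k.
by case: (leqP T (2 * k)); case: (leqP T (2 * (T.+1 - k.+1))) => //; lia.
Qed.

(** Half of the lower bound obtained below for the mean number of visited sites of the cube. *)
Definition visit_bound (rho : nat) : R :=
  cube_prob R d * (rho ^ 2)%:R / (4 * green R d (rho ^ 2)).

(** With [T = rho^2] and [c = cube_prob R d], the walk spends in the cube a mean time of at least
    [c T / 2]. Division by the Green function bounds the mean number of visited sites from below,
    and Paley-Zygmund applies. *)
Lemma many_visits_in_cube rho x z : (20 * d <= rho)%N -> near_cube rho x z ->
  cube_prob R d / 48 <= walkE (rho ^ 2) (fun w =>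
     ((visit_bound rho <= nvisited R (cube_seq z (4 * rho)) x w)%R)%:R).
Proof.
move=> drho near; set T := (rho ^ 2)%N; set V := cube_seq _ _.
have c0 := cube_prob_gt0 R d; set c := cube_prob R d in c0 *.
have T0 : (0 < T)%N by rewrite /T expn_gt0; lia.
have T0R : 1 <= T%:R :> R by rewrite ler1n.
have g0 := green_gt0 R d_gt0 T.
have uV : uniq V by exact: cube_seq_uniq.
have aE : c * T%:R / 2 / green R d T <= walkE T (nvisited R V x).
  rewrite ler_pdivrMr // walkE_nvisited mulr_suml.
  apply: (@le_trans _ _ (\sum_(v <- V) walkE T (visits R v x))); last first.
    by apply: ler_sum => v _; exact: visits_le_hits.
  rewrite -walk_exp_sum.
  rewrite (@eq_walk_exp _ _ _ _ _ (fun w =>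
     \sum_(k <- index_enum 'I_T.+1) (pos x (take k w) \in V)%:R)); last first.
    by move=> w wT; rewrite sum_visits_time // wT.
  rewrite walk_exp_sum -mulrA.
  apply: le_trans (ler_wpM2l (ltW c0) (half_times T)) _.
  rewrite mulr_sumr; apply: ler_sum => k _.
  have kT : (k <= T)%N by have := ltn_ord k.
  rewrite (walk_exp_take (srw_sum1 R d_gt0) (fun w => (pos x w \in V)%:R) kT).
  case: (boolP (T <= 2 * k)%N) => [kk|_]; last first.
    rewrite mulr0; apply: walk_exp_ge0 => [s||w _].
    - exact: srw_ge0.
    - exact: srw_sum1.
    - exact: ler0n.
  rewrite mulr1; apply: le_trans (walk_in_cube R d_gt0 drho near kk kT) _.
  by apply: le_walk_exp => [s|w _]; [exact: srw_ge0 | rewrite mem_cube_seq].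
have a0 : 0 < c * T%:R / 2 / green R d T.
  by apply: divr_gt0 g0; apply: divr_gt0 => //; apply: mulr_gt0 c0 _; lra.
have -> : visit_bound rho = c * T%:R / 2 / green R d T / 2.
  by rewrite /visit_bound -/T -/c; field; rewrite gt_eqF.
apply: le_trans (nvisited_paley_zygmund d_gt0 uV a0 aE).
rewrite /max_range ler_pdivlMr; last by rewrite mulr_gt0 // divr_gt0.
set g := green R d T in g0 *.
have -> : (2 * T).+1%:R = 2 * T%:R + 1 :> R by rewrite -natr1 natrM.
have -> : c / 48 * (8 * ((2 * T%:R + 1) / g)) = c / g * ((2 * T%:R + 1) / 6).
  by field; rewrite gt_eqF.
have -> : c * T%:R / 2 / g = c / g * (T%:R / 2) by field; rewrite gt_eqF.
(* Here [2 T + 1 <= 3 T], whence 48 as [2 * 8 * 3]. *)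
by apply: ler_wpM2l; [rewrite divr_ge0 ?ltW | lra].
Qed.

Lemma nvisited_size V x w :
  nvisited R V x w = (size [seq v <- V | v \in traj x w])%:R.
Proof.
rewrite /nvisited /hits size_filter -sum1_count natr_sum [in RHS]big_mkcond /=.
by apply: eq_bigr => v _; case: (_ \in _).
Qed.

End CubeVisits.

(** * Bounds on the Green function *)

Section GreenPotential.
Variables (R : realType) (d : nat).
Local Notation site := 'rV[int]_d.
Local Notation step := ('I_d * bool)%type.
Local Notation walkE := (walk_exp (@srw R d)).
Implicit Types (x : site) (w : seq step).
Hypothesis d_gt0 : (0 < d)%N.

(** Every visit to the origin raises the mean of [phi] along the walk by at least [c] at the
    following step, and no other step lowers it. Visits up to time [n] are thus accounted for at
    time [n + 1]. *)
Lemma green_potential (phi : site -> R) (c : R) n x :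
  (forall y, c * (y == 0)%:R + phi y <= \sum_s srw R s * phi (y + step_vec s)) ->
  c * walkE n (visits R 0 x) + phi x <= walkE n.+1 (fun w => phi (pos x w)).
Proof.
move=> sub; elim: n x => [|n IH] x; first by have := sub x; rewrite /= /visits /= addn0.
rewrite walkE_visitsS // mulrDr addrAC; apply: (le_trans (lerD (sub x) (lexx _))).
rewrite mulr_sumr -big_split /=; apply: ler_sum => s _.
rewrite mulrCA -mulrDr; apply: ler_wpM2l; first exact: srw_ge0.
by rewrite addrC; exact: IH.
Qed.

Definition sqnorm x : R := \sum_i coord R x i ^+ 2.

Lemma sqnorm_ge0 x : 0 <= sqnorm x.
Proof. by apply: sumr_ge0 => i _; exact: sqr_ge0. Qed.

Lemma sqnorm0 : sqnorm 0 = 0.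
Proof. by rewrite /sqnorm big1 // => i _; rewrite /coord mxE expr0n. Qed.

Lemma sqnorm_step x s :
  sqnorm (x + step_vec s) = sqnorm x + 1 + 2 * sgb R s.2 * coord R x s.1.
Proof.
rewrite /sqnorm (bigD1 s.1) //= [in RHS](bigD1 s.1) //= coord_step eqxx mul1r.
rewrite (eq_bigr (fun i => coord R x i ^+ 2)); last first.
  by move=> i /negPf ns; rewrite coord_step ns mul0r addr0.
rewrite /sgb; case: s.2; ring.
Qed.

Lemma srw_sum_step (F : R -> 'I_d -> R) : \sum_(s : step) srw R s * F (sgb R s.2) s.1 =
  (2 * d)%:R^-1 * \sum_i (F 1 i + F (-1) i).
Proof.
by rewrite sum_step mulr_sumr; apply: eq_bigr => i _; rewrite /srw /sgb /= mulrDr.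
Qed.

Lemma walkE_sqnorm n x : walkE n (fun w => sqnorm (pos x w)) = sqnorm x + n%:R.
Proof.
elim: n x => [|n IH] x /=; first by rewrite addr0.
under eq_bigr do rewrite IH sqnorm_step.
rewrite (srw_sum_step (fun b i => sqnorm x + 1 + 2 * b * coord R x i + n%:R)).
rewrite (eq_bigr (fun=> 2 * (sqnorm x + 1 + n%:R))); last by move=> i _; ring.
rewrite sumr_const card_ord -[_ *+ d]mulr_natl natrM -[n.+1%:R]natr1; field.
by rewrite pnatr_eq0; lia.
Qed.

End GreenPotential.

Section GreenTwo.
Variable R : realType.
Local Notation site := 'rV[int]_2.
Local Notation walkE := (walk_exp (@srw R 2)).

(* With [y = |x|^2 + 1], the product of the four neighbouring values of [y] is at
   least [y^4], so [ln (|x|^2 + 1)] is subharmonic. *)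
Lemma ln_sqnorm_subharmonic (x : site) :
  ln 2 * (x == 0)%:R + ln (sqnorm R x + 1)
    <= \sum_s srw R s * ln (sqnorm R (x + step_vec s) + 1).
Proof.
under eq_bigr do rewrite sqnorm_step.
rewrite (srw_sum_step (fun b i => ln (sqnorm R x + 1 + 2 * b * coord R x i + 1))).
case: (eqVneq x 0) => [->|_].
  rewrite sqnorm0 !add0r ln1 addr0 mulr1 !big_ord_recl big_ord0 /= /coord !mxE.
  by rewrite !mulr0 !addr0 -[1 + 1]/2; lra.
rewrite mulr0 add0r /sqnorm !big_ord_recl !big_ord0 /= !addr0.
set a := coord R x _; set b := coord R x _.
rewrite ler_pdivlMl // [leLHS]mulr_natl -lnXn; last by nra.
set p1 := _ + 1 + 2 * 1 * a + 1; set p2 := _ + 2 * -1 * a + 1.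
set p3 := _ + 2 * 1 * b + 1; set p4 := _ + 2 * -1 * b + 1.
have p1_gt0 : 0 < p1 by rewrite /p1; nra.
have p2_gt0 : 0 < p2 by rewrite /p2; nra.
have p3_gt0 : 0 < p3 by rewrite /p3; nra.
have p4_gt0 : 0 < p4 by rewrite /p4; nra.
have P : 0 < p1 * p2 * (p3 * p4) by rewrite !mulr_gt0.
have Q : 0 < (a ^+ 2 + b ^+ 2 + 1) ^+ (2 * 2) by rewrite exprn_gt0 //; nra.
rewrite -!lnM ?posrE ?mulr_gt0 // ler_ln //.
have -> : p1 * p2 * (p3 * p4) = (a ^+ 2 + b ^+ 2 + 1) ^+ (2 * 2) +
  (2 * (a ^+ 2 + b ^+ 2 + 1) ^+ 2 + 8 * (a ^+ 2 + b ^+ 2 + 1) + 5 + 16 * a ^+ 2 * b ^+ 2).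
  by rewrite /p1 /p2 /p3 /p4; ring.
rewrite lerDl -mulrA -exprMn; have := sqr_ge0 (a * b); have := sqr_ge0 a; have := sqr_ge0 b.
by move: (a ^+ 2) (b ^+ 2) ((a * b) ^+ 2) => A B C; nra.
Qed.

(** The function [ln (|x|^2 + 1)] replaces the potential kernel of the plane; its mean at time
    [n + 1] is at most [ln (n + 2)] by concavity. *)
Lemma green_two n : green R 2 n <= (ln 2)^-1 * (1 + ln (1 + n%:R)).
Proof.
have ln2 : 0 < ln 2 :> R by rewrite ln_gt0 // ltr1n.
have := @green_potential R 2 isT _ _ n 0 ln_sqnorm_subharmonic.
rewrite sqnorm0 add0r ln1 addr0 -/(green R 2 n) => h.
rewrite ler_pdivlMl //; apply: le_trans h _.
have [m mE] : exists m : R, m = n.+2%:R by exists n.+2%:R.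
have m0 : 0 < m by rewrite mE ltr0n.
have n0 : 0 <= n%:R :> R by exact: ler0n.
(* Jensen's inequality through the tangent of [ln] at [m], which is the mean of [|S|^2 + 1] at time
   [n + 1]. *)
apply: (@le_trans _ _ (walkE n.+1 (fun w => (ln m - 1 + m^-1) + m^-1 * sqnorm R (pos 0 w)))).
  apply: le_walk_exp => [|w _]; first exact: srw_ge0.
  have s0 := sqnorm_ge0 R (pos 0 w); set S := sqnorm R _ in s0 *.
  have -> : S + 1 = m * (1 + ((S + 1) / m - 1)) by field; rewrite gt_eqF.
  have q0 : 0 < (S + 1) / m by rewrite divr_gt0 //; lra.
  rewrite lnM ?posrE //; last by lra.
  have : ln (1 + ((S + 1) / m - 1)) <= (S + 1) / m - 1 by apply: le_ln1Dx; lra.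
  lra.
rewrite walk_expD walk_expZ walk_exp_cst ?srw_sum1 // walkE_sqnorm // sqnorm0 add0r.
have -> : ln m - 1 + m^-1 + m^-1 * n.+1%:R = ln m.
  have -> : n.+1%:R = m - 1 by rewrite mE -[n.+2%:R]natr1 addrK.
  by field; rewrite gt_eqF.
rewrite -[X in _ <= X + _](expRK 1) -lnM ?posrE ?expR_gt0 ?ltr_wpDr //.
rewrite ler_ln ?posrE ?mulr_gt0 ?expR_gt0 ?ltr_wpDr //.
have := @expR_ge1Dx R 1; rewrite mE -[n.+2%:R]natr1 -[n.+1%:R]natr1; nra.
Qed.

End GreenTwo.

Section GreenThree.
Variables (R : realType) (d : nat).
Local Notation site := 'rV[int]_d.
Local Notation walkE := (walk_exp (@srw R d)).
Hypothesis d_ge3 : (3 <= d)%N.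

Definition isqrt (z : R) : R := (Num.sqrt z)^-1.

Lemma isqrt_ge0 z : 0 <= isqrt z.
Proof. by rewrite invr_ge0 sqrtr_ge0. Qed.

Lemma isqrtM z z' : 0 <= z -> isqrt (z * z') = isqrt z * isqrt z'.
Proof. by move=> z0; rewrite /isqrt sqrtrM // invfM. Qed.

Lemma isqrt_le z q : 0 < z -> 0 <= q -> 1 <= q ^+ 2 * z -> isqrt z <= q.
Proof.
move=> z0 q0 h; rewrite /isqrt -(sqrtrV (ltW z0)) -[leRHS](ger0_norm q0) -sqrtr_sqr.
by apply: ler_wsqrtr; rewrite -[leLHS]mul1r ler_pdivrMr.
Qed.

(* Fourth order Taylor polynomial of [(1 + v)^(-1/2)], with its last coefficient
   [35/128] raised to [1]. *)
Lemma isqrt1D_le v : `|v| <= 1 / 2 ->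
  isqrt (1 + v) <= 1 - v / 2 + 3 / 8 * v ^+ 2 - 5 / 16 * v ^+ 3 + v ^+ 4.
Proof.
rewrite ler_norml => /andP[v1 v2].
have s0 : 0 <= v ^+ 2 by exact: sqr_ge0.
have s1 : v ^+ 2 <= 1 / 4 by nra.
have c1 : - (1 / 8) <= v ^+ 3 <= 1 / 8.
  by rewrite exprS; apply/andP; split; nra.
have f0 : 0 <= v ^+ 4 by rewrite -[4%N]/(2 * 2)%N exprM sqr_ge0.
have f1 : - (1 / 32) <= v ^+ 5 <= 1 / 32.
  have -> : v ^+ 5 = v ^+ 2 * v ^+ 3 by rewrite -exprD.
  by move: c1 => /andP[c1 c2]; apply/andP; split; nra.
move: c1 f1 => /andP[c1 c2] /andP[f1 f2].
apply: isqrt_le; [lra|lra|].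
rewrite -subr_ge0.
(* The square agrees with the series of [1 / (1 + v)] up to order three, so [v^4] factors out; the
   other factor is nonnegative for [|v| <= 1 / 2]. *)
have -> : (1 - v / 2 + 3 / 8 * v ^+ 2 - 5 / 16 * v ^+ 3 + v ^+ 4) ^+ 2 * (1 + v) - 1
  = v ^+ 4 * (93 / 64 + 78 / 64 * v - 99 / 256 * v ^+ 2 + 57 / 256 * v ^+ 3
              + 3 / 8 * v ^+ 4 + v ^+ 5) by field.
apply: mulr_ge0; first exact: f0.
move: (v ^+ 2) (v ^+ 3) (v ^+ 4) (v ^+ 5) s0 s1 c1 c2 f0 f1 f2 => A B C D *; lra.
Qed.

(** It refers the value at a site to [Y], which will be the mean over the neighbours of the shifted
    squared norm. *)
Lemma isqrt_pred Y : 1 < Y -> isqrt Y * (1 + (2 * Y)^-1) <= isqrt (Y - 1).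
Proof.
move=> Y1.
have sY : 0 < Num.sqrt Y by rewrite sqrtr_gt0; lra.
have sY1 : 0 < Num.sqrt (Y - 1) by rewrite sqrtr_gt0; lra.
have t0 : 0 < (2 * Y)^-1 by rewrite invr_gt0; lra.
have u0 : 0 <= 1 + (2 * Y)^-1 by lra.
rewrite /isqrt -[leRHS]mul1r ler_pdivlMr // -mulrA ler_pdivrMl // mulr1.
rewrite -[X in X * _ <= _](ger0_norm u0) -sqrtr_sqr -sqrtrM ?sqr_ge0 //.
apply: ler_wsqrtr.
have -> : (1 + (2 * Y)^-1) ^+ 2 * (Y - 1)
  = Y - (3 * Y + 1) * (2 * Y)^-1 ^+ 2 by field; lra.
by rewrite lerBlDr lerDl mulr_ge0 ?sqr_ge0 //; lra.
Qed.

Let d_gt0 : (0 < d)%N. Proof. exact: leq_trans d_ge3. Qed.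

Definition green_const3 : R := (isqrt 10 - isqrt 11)^-1 * isqrt 10.

Lemma isqrt11_lt : isqrt 11 < isqrt 10.
Proof.
by rewrite /isqrt ltf_pV2 ?posrE ?sqrtr_gt0 // ltr_sqrt // ltr_nat.
Qed.

(** In dimension at least three [1 / |x|] is superharmonic; the shift by 10 removes the singularity
    and absorbs the discretisation error. The sign is reversed to fit [green_potential]. *)
Lemma isqrt_sqnorm_superharmonic (x : site) :
  (isqrt 10 - isqrt 11) * (x == 0)%:R + - isqrt (sqnorm R x + 10)
    <= \sum_s srw R s * - isqrt (sqnorm R (x + step_vec s) + 10).
Proof.
under [leRHS]eq_bigr do rewrite sqnorm_step mulrN.
rewrite sumrN.
rewrite (srw_sum_step (fun b i => isqrt (sqnorm R x + 1 + 2 * b * coord R x i + 10))).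
have dR : 0 < d%:R :> R by rewrite ltr0n.
case: (eqVneq x 0) => [->|_].
  rewrite sqnorm0 !add0r [_ * true%:R]mulr1 addrAC subrr add0r lerN2.
  rewrite (eq_bigr (fun=> 2 * isqrt 11)); last first.
    move=> i _; have e b : 1 + 2 * b * coord R 0 i + 10 = 11 by rewrite /coord mxE; ring.
    by rewrite !e; ring.
  rewrite sumr_const card_ord -[_ *+ d]mulr_natl natrM.
  by rewrite le_eqVlt; apply/orP; left; apply/eqP; field; rewrite gt_eqF.
rewrite mulr0 add0r lerN2; set N := sqnorm R x.
have N0 : 0 <= N by exact: sqnorm_ge0.
set Y := N + 11.
pose v i := 2 * coord R x i / Y.
have Y0 : 0 < Y by rewrite /Y; lra.
have vB i : `|v i| <= 1 / 2.
  have : coord R x i ^+ 2 <= N.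
    rewrite /N /sqnorm (bigD1 i) //= lerDl; apply: sumr_ge0 => j _; exact: sqr_ge0.
  rewrite /v ler_norml ler_pdivrMr // ler_pdivlMr // /Y => h; apply/andP.
  have := sqr_ge0 (coord R x i - 2); have := sqr_ge0 (coord R x i + 2).
  by split; nra.
pose e : R := \sum_i v i ^+ 2.
have eE : e = 4 * N / Y ^+ 2.
  rewrite /e /N /sqnorm mulr_sumr mulr_suml; apply: eq_bigr => i _.
  by rewrite /v; field; rewrite gt_eqF.
have e4 : \sum_i v i ^+ 4 <= e ^+ 2.
  rewrite expr2 {1}/e mulr_suml; apply: ler_sum => i _.
  have -> : v i ^+ 4 = v i ^+ 2 * v i ^+ 2 by rewrite -exprD.
  apply: ler_wpM2l; first exact: sqr_ge0.
  by rewrite /e (bigD1 i) //= lerDl; apply: sumr_ge0 => j _; exact: sqr_ge0.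
have -> : N + 10 = Y - 1 by rewrite /Y; ring.
apply: le_trans (isqrt_pred _); last by rewrite /Y; lra.
apply: (@le_trans _ _ ((2 * d)%:R^-1 * (isqrt Y * (2 * (d%:R + 3 / 8 * e + e ^+ 2))))).
  apply: ler_wpM2l; first by rewrite invr_ge0.
  apply: (@le_trans _ _ (isqrt Y * (2 * (d%:R + 3 / 8 * e + \sum_i v i ^+ 4)))).
    have -> : d%:R + 3 / 8 * e + \sum_i v i ^+ 4 = \sum_i (1 + 3 / 8 * v i ^+ 2 + v i ^+ 4).
      by rewrite !big_split /= sumr_const card_ord /e mulr_sumr.
    rewrite !mulr_sumr; apply: ler_sum => i _.
    have sp b : N + 1 + 2 * b * coord R x i + 10 = Y * (1 + b * v i).
      by rewrite /v /Y; field; rewrite gt_eqF.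
    rewrite !sp !(isqrtM _ (ltW Y0)) -mulrDr; apply: ler_wpM2l; first exact: isqrt_ge0.
    (* Odd powers cancel between the two neighbours in direction [i]. *)
    have := isqrt1D_le (vB i).
    have := @isqrt1D_le (- v i); rewrite normrN => /(_ (vB i)).
    rewrite mul1r mulN1r; have -> : (- v i) ^+ 3 = - v i ^+ 3 by ring.
    by have -> : (- v i) ^+ 4 = v i ^+ 4 by [ring]; rewrite sqrrN; lra.
  apply: ler_wpM2l; first exact: isqrt_ge0.
  by apply: ler_wpM2l => //; lra.
rewrite mulrCA; apply: ler_wpM2l; first exact: isqrt_ge0.
rewrite natrM invfM mulrACA mulVf // mul1r ler_pdivrMl //.
have e0 : 0 <= e by apply: sumr_ge0 => i _; exact: sqr_ge0.
have d3 : 3 <= d%:R :> R by rewrite ler_nat.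
suff h : 3 / 8 * e + e ^+ 2 <= 3 * (2 * Y)^-1.
  have : 0 <= (2 * Y)^-1 by rewrite invr_ge0; lra.
  nra.
(* As [N = Y - 11], the linear term in [e] leaves a surplus [(33 / 2) / Y^2], larger than the at
   most [16 / Y^2] coming from [e ^+ 2]. The shift by 10 is chosen for this. *)
have -> : 3 / 8 * e + e ^+ 2 = 3 * (2 * Y)^-1 - (33 / 2 - 16 * (N / Y) ^+ 2) / Y ^+ 2.
  by rewrite eE /Y; field; rewrite gt_eqF.
rewrite gerBl divr_ge0 ?sqr_ge0 //.
have n1 : N / Y <= 1 by rewrite ler_pdivrMr //; rewrite /Y; lra.
have n0 : 0 <= N / Y by rewrite divr_ge0 // ltW.
nra.
Qed.

(** The potential never exceeds 0, so from the origin it can increase by at most [isqrt 10],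
    uniformly in [n]. *)
Lemma green_three n : green R d n <= green_const3.
Proof.
have := @green_potential R d d_gt0 _ _ n 0 isqrt_sqnorm_superharmonic.
rewrite sqnorm0 add0r -/(green R d n) => h.
have l : 0 < isqrt 10 - isqrt 11 by rewrite subr_gt0 isqrt11_lt.
rewrite /green_const3 ler_pdivlMl //.
suff : walkE n.+1 (fun w => - isqrt (sqnorm R (pos 0 w) + 10)) <= 0 by lra.
apply: walk_exp_le_cst => [s||w _].
- exact: srw_ge0.
- exact: srw_sum1.
- by rewrite oppr_le0 isqrt_ge0.
Qed.

End GreenThree.

(** * Adaptive exploration of the environment *)

Section Programs.
Variables (R : realType) (d : nat) (r : R) (H : nat).
Local Notation site := 'rV[int]_d.
Local Notation step := ('I_d * bool)%type.
Implicit Types (x y : site) (t : seq step) (jo jw : pred site).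

(* [AskO x k] reveals the occupation of [x], [AskW x k] the first [H] steps of the walk
   started at [x]. *)
Inductive prog (B : Type) : Type :=
| Ret of B
| AskO of site & (bool -> prog B)
| AskW of site & (seq step -> prog B).

Fixpoint bind (B C : Type) (p : prog B) (k : B -> prog C) : prog C :=
  match p with
  | Ret b => k b
  | AskO x q => AskO x (fun c => bind (q c) k)
  | AskW x q => AskW x (fun t => bind (q t) k)
  end.

Fixpoint val (B : Type) (p : prog B) (f : B -> R) : R :=
  match p with
  | Ret b => f b
  | AskO x q => r * val (q true) f + (1 - r) * val (q false) f
  | AskW x q => walk_exp (@srw R d) H (fun t => val (q t) f)
  end.

(** A queried site is withdrawn from the permitted set, so nothing is asked twice along a branch.
    This entitles [val] to treat every answer as independent of the past. *)
Fixpoint within (B : Type) (p : prog B) (jo jw : pred site) : Prop :=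
  match p with
  | Ret b => True
  | AskO x q => jo x /\ forall c, within (q c) (fun y => jo y && (y != x)) jw
  | AskW x q => jw x /\ forall t, within (q t) jo (fun y => jw y && (y != x))
  end.

Lemma within_sub B (p : prog B) jo jw jo' jw' :
  (forall x, jo x -> jo' x) -> (forall x, jw x -> jw' x) ->
  within p jo jw -> within p jo' jw'.
Proof.
elim: p jo jw jo' jw' => [b|x q IH|x q IH] jo jw jo' jw' so sw //= [jx wq].
  split; first exact: so.
  by move=> c; apply: IH (wq c) => // y /andP[/so -> ->].
split; first exact: sw.
by move=> c; apply: IH (wq c) => // y /andP[/sw -> ->].
Qed.

Lemma val_bind B C (p : prog B) (k : B -> prog C) f :
  val (bind p k) f = val p (fun b => val (k b) f).
Proof.
elim: p => [b|x q IH|x q IH] //=; first by rewrite !IH.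
by apply: eq_walk_exp => t _; rewrite IH.
Qed.

Hypothesis r01 : 0 <= r <= 1.
Hypothesis d_gt0 : (0 < d)%N.

Lemma le_val B (p : prog B) (f g : B -> R) :
  (forall b, f b <= g b) -> val p f <= val p g.
Proof.
move=> fg; move: r01 => /andP[r0 r1].
elim: p => [b|x q IH|x q IH] //=.
  by apply: lerD; apply: ler_wpM2l => //; rewrite subr_ge0.
by apply: le_walk_exp => [s|t _] //; exact: srw_ge0.
Qed.

Lemma eq_val B (p : prog B) (f g : B -> R) : f =1 g -> val p f = val p g.
Proof.
by move=> fg; apply/eqP; rewrite eq_le !le_val // => b; rewrite fg.
Qed.

Lemma valD B (p : prog B) (f g : B -> R) :
  val p (fun b => f b + g b) = val p f + val p g.
Proof.
elim: p => [b|x q IH|x q IH] //=; first by rewrite !IH; ring.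
by rewrite -walk_expD; apply: eq_walk_exp => t _.
Qed.

Lemma valZ B (p : prog B) c (f : B -> R) : val p (fun b => c * f b) = c * val p f.
Proof.
elim: p => [b|x q IH|x q IH] //=; first by rewrite !IH; ring.
by rewrite -walk_expZ; apply: eq_walk_exp => t _.
Qed.

Lemma val_cst B (p : prog B) c : val p (fun=> c) = c.
Proof.
elim: p => [b|x q IH|x q IH] //=; first by rewrite !IH; ring.
by under eq_walk_exp do rewrite IH; rewrite walk_exp_cst // srw_sum1.
Qed.

Definition prob B (p : prog B) (g : B -> bool) : R := val p (fun b => (g b)%:R).

Lemma prob_ge0 B (p : prog B) g : 0 <= prob p g.
Proof.
by rewrite -(val_cst p 0); apply: le_val => b; exact: ler0n.
Qed.

Lemma prob_le1 B (p : prog B) g : prob p g <= 1.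
Proof.
by rewrite -(val_cst p 1); apply: le_val => b; rewrite lern1 leq_b1.
Qed.

Lemma probC B (p : prog B) g : prob p (fun b => ~~ g b) = 1 - prob p g.
Proof.
apply/eqP; rewrite eq_sym subr_eq eq_sym -valD -[X in _ == X](val_cst p); apply/eqP.
by apply: eq_val => b; case: (g b); rewrite /= ?addr0 ?add0r.
Qed.

Lemma prob_sub B (p : prog B) (g g' : B -> bool) :
  (forall b, g b -> g' b) -> prob p g <= prob p g'.
Proof.
by move=> gg; apply: le_val => b; rewrite ler_nat; case: (g b) (gg b) => // ->.
Qed.

Section Semantics.
Variables (Omega : Type) (om : site -> Omega -> bool) (S : site -> nat -> Omega -> site).

Definition follows x t (w : Omega) : Prop :=
  forall k, (k <= size t)%N -> S x k w = pos x (take k t).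

(** Of the two readings of a run, the existential one is the event whose probability is bounded
    below. The universal one, [holds], suits pathwise consequences and is vacuous where a queried
    walk makes an illegal step. [sem_holds] joins them. *)
Fixpoint sem (B : Type) (p : prog B) (Q : B -> Prop) (w : Omega) : Prop :=
  match p with
  | Ret b => Q b
  | AskO x q => sem (q (om x w)) Q w
  | AskW x q => exists t, size t = H /\ follows x t w /\ sem (q t) Q w
  end.

Fixpoint holds (B : Type) (p : prog B) (Q : B -> Prop) (w : Omega) : Prop :=
  match p with
  | Ret b => Q b
  | AskO x q => holds (q (om x w)) Q w
  | AskW x q => forall t, size t = H -> follows x t w -> holds (q t) Q w
  end.

Lemma sem_holds B (p : prog B) Q Q' w : sem p Q w -> holds p Q' w ->
  exists2 b, Q b & Q' b.
Proof.
elim: p => [b|x q IH|x q IH] /=; [by exists b|exact: IH|].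
by move=> [t [st [ft sq]]] hq; apply: IH sq (hq t st ft).
Qed.

Lemma holds_sub B (p : prog B) (Q Q' : B -> Prop) w :
  (forall b, Q b -> Q' b) -> holds p Q w -> holds p Q' w.
Proof.
move=> QQ; elim: p => [b|x q IH|x q IH] /=; [exact: QQ|exact: IH|].
by move=> h t st ft; exact: IH (h t st ft).
Qed.

Lemma holds_bind B C (p : prog B) (k : B -> prog C) Q w :
  holds p (fun b => holds (k b) Q w) w -> holds (bind p k) Q w.
Proof.
elim: p => [b|x q IH|x q IH] //=; first exact: IH.
by move=> h t st ft; exact: IH (h t st ft).
Qed.

End Semantics.
End Programs.

(** * Programs under the law of the frog model *)

Section DisjointSum.
Local Open Scope classical_set_scope.
Context {R : realType} {dT : measure_display} {Omega : measurableType dT}.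
Variable P : probability Omega R.

Lemma sum_disjoint_le (I : eqType) (s : seq I) (A : I -> set Omega) (B : set Omega) :
  uniq s -> (forall i, measurable (A i)) -> measurable B ->
  {in s, forall i, A i `<=` B} ->
  {in s &, forall i j, i != j -> A i `&` A j = set0} ->
  (\sum_(i <- s) P (A i) <= P B)%E.
Proof.
elim: s B => [|i s IH] B; first by rewrite big_nil.
move=> /= /andP[nis us] mA mB sub dis; rewrite big_cons (measureDI P mB (mA i)) addeC.
have iB : A i `<=` B by apply: sub; rewrite mem_head.
rewrite setIC (setIidl iB) leeD2r //.
apply: IH => // [|j js|j k js ks]; first exact: measurableD.
  move=> w jw; split; first by apply: (sub j) => //; rewrite inE js orbT.
  move=> iw; have : (A i `&` A j) w by [].
  rewrite dis ?inE ?eqxx ?js ?orbT //.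
  by apply: contraNneq nis => ->.
by apply: dis; rewrite inE ?js ?ks orbT.
Qed.

End DisjointSum.

Lemma count_lt (T : eqType) (a a' : pred T) (s : seq T) x :
  x \in s -> a x -> ~~ a' x -> subpred a' a -> (count a' s < count a s)%N.
Proof.
move=> xs ax nax sub; elim: s xs => //= y s IH; rewrite inE => /orP[/eqP <-|/IH].
  by rewrite ax (negPf nax) add0n add1n ltnS; exact: sub_count.
by case: (a' y) (sub y) => [/(_ isT) ->|_] lt; [rewrite ltn_add2l | exact: ltn_addl].
Qed.

Section Words.
Variables (R : realType) (A : finType).

Fixpoint words (n : nat) : seq (seq A) :=
  if n is n'.+1 then [seq s :: w | s <- index_enum A, w <- words n'] else [:: [::]].

Lemma words_uniq n : uniq (words n).
Proof.
elim: n => //= n IH; apply: allpairs_uniq => //; first exact: index_enum_uniq.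
by move=> [a u] [b v] _ _ [-> ->].
Qed.

Lemma size_words n w : w \in words n -> size w = n.
Proof.
elim: n w => [|n IH] w /=; first by rewrite inE => /eqP->.
by move=> /allpairsP[[a u] [_ /IH /= <- ->]].
Qed.

Lemma mem_words n w : (w \in words n) = (size w == n).
Proof.
elim: n w => [|n IH] [|s w] //=.
  by apply/allpairsP => -[[a u] []].
rewrite eqSS -IH; apply/allpairsP/idP => [[[a u] [_ /= hu [_ ->]]] //|hw].
by exists (s, w); split=> //; rewrite mem_index_enum.
Qed.

Lemma walk_exp_words (c : R) n f :
  walk_exp (fun _ : A => c) n f = \sum_(w <- words n) c ^+ n * f w.
Proof.
elim: n f => [|n IH] f /=; first by rewrite big_seq1 expr0 mul1r.
rewrite big_allpairs_dep /=; apply: eq_bigr => s _.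
by rewrite IH mulr_sumr; apply: eq_bigr => w _; rewrite exprS mulrA.
Qed.

End Words.

Section FrogLaw.
Local Open Scope classical_set_scope.
Variables (R : realType) (d : nat) (r : R) (H : nat).
Local Notation site := 'rV[int]_d.
Local Notation step := ('I_d * bool)%type.
Variables (dT : measure_display) (Omega : measurableType dT).
Variable P : probability Omega R.
Variables (om : site -> Omega -> bool) (S : site -> nat -> Omega -> site).
Hypothesis d_gt0 : (0 < d)%N.
Hypothesis law : frog_law P r om S.
Implicit Types (x y : site) (b : site -> bool) (O W : seq site) (T : site -> seq step).

Definition bern (c : bool) : R := if c then r else 1 - r.
Definition path_weight : R := (2 * d)%:R^-1 ^+ H.

Definition om_event x c : set Omega := [set w | om x w = c].
Definition walk_event x t : set Omega :=
  [set w | forall k, (k <= H)%N -> S x k w = pos x (take k t)].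

(** Occupations and walks may be prescribed on different sites, as happens along a branch of a
    program; [frog_law] prescribes both on the same sites. *)
Definition cyl O b W T : set Omega :=
  [set w | {in O, forall x, om_event x (b x) w} /\ {in W, forall x, walk_event x (T x) w}].

Definition cyl_weight O b W : R := (\prod_(x <- O) bern (b x)) * path_weight ^+ size W.

Lemma measurable_om_event x c : measurable (om_event x c).
Proof. by case: law => h _; exact: h. Qed.

Lemma measurable_walk_event x t : measurable (walk_event x t).
Proof.
rewrite (_ : walk_event x t =
   \bigcap_(k in [set k | (k <= H)%N]) [set w | S x k w = pos x (take k t)]) //.
by apply: bigcap_measurableType => k _; case: law => _ [h _]; exact: h.
Qed.

Lemma measurable_cyl O b W T : measurable (cyl O b W T).
Proof.
rewrite (_ : cyl O b W T = (\bigcap_(x in [set` O]) om_event x (b x)) `&`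
   (\bigcap_(x in [set` W]) walk_event x (T x))) //.
apply: measurableI; apply: fin_bigcap_measurable => [|x _]; try exact: finite_seq.
  exact: measurable_om_event.
exact: measurable_walk_event.
Qed.

Lemma cyl_consO O b W T x c : x \notin O ->
  cyl (x :: O) (fun y => if y == x then c else b y) W T = om_event x c `&` cyl O b W T.
Proof.
move=> xO; apply/seteqP; split=> w.
  move=> [hO hW]; split; first by have := hO x (mem_head _ _); rewrite eqxx.
  split=> // y yO; have := hO y; rewrite inE yO orbT => /(_ isT).
  by case: eqP yO xO => // -> ->.
move=> [hx [hO hW]]; split=> // y; rewrite inE; case: eqP => [->|_] //= yO.
exact: hO _ yO.
Qed.

Lemma cyl_consW O b W T x t : x \notin W ->
  cyl O b (x :: W) (fun y => if y == x then t else T y) = walk_event x t `&` cyl O b W T.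
Proof.
move=> xW; apply/seteqP; split=> w.
  move=> [hO hW]; split; first by have := hW x (mem_head _ _); rewrite eqxx.
  split=> // y yW; have := hW y; rewrite inE yW orbT => /(_ isT).
  by case: eqP yW xW => // -> ->.
move=> [hx [hO hW]]; split=> // y; rewrite inE; case: eqP => [->|_] //= yW.
exact: hW _ yW.
Qed.

Lemma cyl_weight_consO O b W x c : x \notin O ->
  cyl_weight (x :: O) (fun y => if y == x then c else b y) W = bern c * cyl_weight O b W.
Proof.
move=> xO; rewrite /cyl_weight big_cons eqxx -mulrA; congr (_ * (_ * _)).
rewrite big_seq [RHS]big_seq; apply: eq_bigr => y yO.
by case: eqP yO xO => // -> ->.
Qed.

Lemma cyl_weight_consW O b W x : cyl_weight O b (x :: W) = path_weight * cyl_weight O b W.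
Proof. by rewrite /cyl_weight /= exprS mulrCA. Qed.

Lemma words_weight : \sum_(t <- words step H) path_weight = 1.
Proof.
have := walk_exp_cst (srw_sum1 R d_gt0) H 1; rewrite walk_exp_words => <-.
by apply: eq_bigr => t _; rewrite mulr1.
Qed.

(** Positions determine steps because [step_vec] is injective; distinct answers to a walk query are
    therefore disjoint events. *)
Lemma walk_event_inj x t t' w : size t = H -> size t' = H ->
  walk_event x t w -> walk_event x t' w -> t = t'.
Proof.
move=> st st' ht ht'.
have e k : (k <= H)%N -> pos x (take k t) = pos x (take k t').
  by move=> kH; rewrite -ht // ht'.
have vinj : injective (@step_vec d).
  move=> [i []] [j []] /rowP /(_ i); rewrite /step_vec /= !mxE eqxx /=;
    case: (eqVneq i j) => [->|] //=.
suff h n : (n <= H)%N -> take n t = take n t'.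
  by have := h H (leqnn _); rewrite -{1}st -st' !take_size => ->.
elim: n => [|n IH] nH; first by rewrite !take0.
case: t st ht e IH => [|s0 t] st ht e IH; first by move: nH; rewrite -st.
have tn : (n < size (s0 :: t))%N by rewrite st.
have tn' : (n < size t')%N by rewrite st'.
rewrite (take_nth s0 tn) (take_nth s0 tn') IH; last exact: ltnW.
congr rcons; apply: vinj; have := e n.+1 nH.
rewrite (take_nth s0 tn) (take_nth s0 tn') IH; last exact: ltnW.
by rewrite !pos_sum -!cats1 !big_cat /= !big_seq1 => /addrI /addrI.
Qed.

Lemma nn_path_pos x t : nn_path (fun k => pos x (take k t)) x (size t).
Proof.
apply/andP; split; first by rewrite take0.
apply/forallP => k; case: t k => [[] //|s0 t] k.
rewrite (take_nth s0) // !pos_sum -cats1 big_cat /= big_seq1.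
rewrite opprD addrACA subrr add0r addrAC subrr add0r.
set s := nth _ _ _; apply/eqP; rewrite /l1z (bigD1 s.1) //= big1.
  by rewrite /step_vec; case: s.2; rewrite !mxE !eqxx ?normrN addr0.
by move=> i /negPf ns; rewrite /step_vec; case: s.2; rewrite !mxE eqxx ns /= ?oppr0 normr0.
Qed.

Lemma ask_walk_le x O b W T (E : seq step -> set Omega) (c : seq step -> R)
    (B : set Omega) : x \notin W -> (forall t, measurable (E t)) -> measurable B ->
  (forall t, size t = H ->
     ((c t)%:E <= P (cyl O b (x :: W) (fun y => if y == x then t else T y) `&` E t))%E) ->
  (forall t, size t = H -> walk_event x t `&` cyl O b W T `&` E t `<=` B) ->
  ((\sum_(t <- words step H) c t)%:E <= P B)%E.
Proof.
move=> xW mE mB cE EB.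
apply: le_trans (@sum_disjoint_le _ _ _ P _ (words step H)
  (fun t => cyl O b (x :: W) (fun y => if y == x then t else T y) `&` E t) B _ _ _ _ _) => //.
- rewrite -sumEFin big_seq [leRHS]big_seq; apply: lee_sum => t /size_words; exact: cE.
- exact: words_uniq.
- by move=> t; apply: measurableI => //; exact: measurable_cyl.
- by move=> t /size_words st; rewrite cyl_consW //; exact: EB.
- move=> t t' /size_words st /size_words st' tt'; apply/seteqP; split=> // w.
  rewrite !cyl_consW // => -[[[ht _] _] [[ht' _] _]].
  by move: tt'; rewrite (walk_event_inj st st' ht ht') eqxx.
Qed.

Lemma ask_om_le x O b W T (E : bool -> set Omega) (c : bool -> R)
    (B : set Omega) : x \notin O -> (forall a, measurable (E a)) -> measurable B ->
  (forall a, ((c a)%:E <= P (cyl (x :: O) (fun y => if y == x then a else b y) W T `&` E a))%E) ->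
  (forall a, om_event x a `&` cyl O b W T `&` E a `<=` B) ->
  ((c true + c false)%:E <= P B)%E.
Proof.
move=> xO mE mB cE EB.
apply: le_trans (@sum_disjoint_le _ _ _ P _ [:: true; false]
  (fun a => cyl (x :: O) (fun y => if y == x then a else b y) W T `&` E a) B _ _ _ _ _) => //.
- by rewrite big_cons big_seq1 EFinD leeD.
- by move=> a; apply: measurableI => //; exact: measurable_cyl.
- by move=> a _; rewrite cyl_consO //; exact: EB.
- move=> a a' _ _ aa'; apply/seteqP; split=> // w.
  rewrite !cyl_consO // => -[[[ht _] _] [[ht' _] _]].
  by move: aa'; rewrite -ht -ht' eqxx.
Qed.

(** When [O] and [W] have the same elements this is [frog_law]. A site in only one of the two is
    added to the other by summing over its possible answers, and the induction is on the number of
    such sites. *)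
Lemma cyl_ge O b W T : uniq O -> uniq W -> (forall x, size (T x) = H) ->
  ((cyl_weight O b W)%:E <= P (cyl O b W T))%E.
Proof.
move: {2}(_ + _)%N (leqnn (count (fun x => x \notin W) O + count (fun x => x \notin O) W)).
move=> n; elim: n O b W T => [|n IH] O b W T hn uO uW sT.
  have OW : O =i W.
    move: hn; rewrite leqn0 addn_eq0 !eqn0Ngt -!has_count => /andP[/hasPn h1 /hasPn h2].
    move=> x; apply/idP/idP => [/h1|/h2]; by rewrite negbK.
  have [_ [_]] := law => /(_ O H b (fun x k => pos x (take k (T x))) uO) h.
  rewrite (_ : cyl O b W T = \bigcap_(x in [set` O]) ([set w | om x w = b x] `&`
      \bigcap_(k in `I_H.+1) [set w | S x k w = pos x (take k (T x))])); last first.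
    apply/seteqP; split=> w.
      move=> [hO hW] x /= xO; split; first exact: hO.
      by move=> k /=; rewrite ltnS; apply: hW; rewrite -OW.
    move=> hw; split=> x xO; first by case: (hw x xO).
    by move=> k kH; have [_] := hw x (eq_ind_r is_true xO (OW x)); apply.
  rewrite h lee_fin le_eqVlt; apply/orP; left; apply/eqP.
  rewrite /cyl_weight big_split /=; congr (_ * _).
  rewrite (eq_bigr (fun=> path_weight)); last first.
    by move=> x _; rewrite -{1}(sT x) nn_path_pos /path_weight exprVn.
  rewrite big_const_seq count_predT iter_mulr_1.
  by rewrite (perm_size (uniq_perm uO uW OW)).
have cE : cyl_weight O b W = \sum_(t <- words step H) path_weight * cyl_weight O b W.
  by rewrite -mulr_suml words_weight mul1r.
have [/hasP[x xO xW]|nO] := boolP (has (fun x => x \notin W) O).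
  rewrite cE; apply: (@ask_walk_le x O b W T (fun=> setT)) => //; first exact: measurable_cyl.
    move=> t st; rewrite setIT -(cyl_weight_consW O b W x); apply: IH => //=.
    - rewrite xO add0n -ltnS; apply: leq_trans hn; rewrite ltn_add2r.
      apply: (@count_lt _ _ _ _ x) => //; first by rewrite inE eqxx.
      by move=> y /=; rewrite inE negb_or => /andP[].
    - by rewrite xW.
    - by move=> y; case: ifP.
  by move=> t _ w [[]].
have [/hasP[x xW xO]|nW] := boolP (has (fun x => x \notin O) W); last first.
  by apply: (IH O b W T) => //; move: nO nW; rewrite !has_count -!eqn0Ngt => /eqP-> /eqP->.
have -> : cyl_weight O b W = bern true * cyl_weight O b W + bern false * cyl_weight O b W.
  by rewrite -mulrDl /bern addrC subrK mul1r.
apply: (@ask_om_le x O b W T (fun=> setT) (fun a => bern a * cyl_weight O b W)) => //.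
- exact: measurable_cyl.
- move=> a; rewrite setIT -(cyl_weight_consO b W a xO); apply: IH => //=.
  + rewrite xW add0n -ltnS; apply: leq_trans hn; rewrite ltn_add2l.
    apply: (@count_lt _ _ _ _ x) => //; first by rewrite inE eqxx.
    by move=> y /=; rewrite inE negb_or => /andP[].
  + by rewrite xO.
- by move=> a w [[]].
Qed.

Lemma measurable_sem B (p : prog d B) (Q : B -> bool) :
  measurable [set w | sem H om S p Q w].
Proof.
elim: p => [b|x q IH|x q IH] /=.
- case: (Q b); last by rewrite (_ : [set _ | _] = set0) //; apply/seteqP; split.
  by rewrite (_ : [set _ | _] = setT) //; apply/seteqP; split.
- rewrite (_ : [set w | _] =
    (om_event x true `&` [set w | sem H om S (q true) Q w]) `|`
    (om_event x false `&` [set w | sem H om S (q false) Q w])).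
    by apply: measurableU; apply: measurableI => //; exact: measurable_om_event.
  apply/seteqP; split=> w; rewrite /om_event /=; first by case: (om x w); [left|right].
  by move=> [] [-> ].
- rewrite (_ : [set w | _] = \bigcup_(t in [set` words step H])
    (walk_event x t `&` [set w | sem H om S (q t) Q w])).
    apply: fin_bigcup_measurable => [|t _]; first exact: finite_seq.
    by apply: measurableI => //; exact: measurable_walk_event.
  apply/seteqP; split=> w.
    move=> [t [st [ft sq]]]; exists t; last by split=> // k kH; apply: ft; rewrite st.
    by rewrite /= mem_words st.
  move=> [t /= /size_words st [ft sq]]; exists t; split=> //; split=> // k.
  by rewrite st; exact: ft.
Qed.

(** The cylinder records the answers received so far. They lie outside [jo] and [jw], so each query
    extends it by a new site and the weights multiply as in [val]. *)
Lemma val_le_cyl B (p : prog d B) (Q : B -> bool) jo jw O b W T :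
  within p jo jw -> uniq O -> uniq W -> (forall x, size (T x) = H) ->
  (forall x, x \in O -> ~~ jo x) -> (forall x, x \in W -> ~~ jw x) ->
  ((cyl_weight O b W * prob r H p Q)%:E
     <= P (cyl O b W T `&` [set w | sem H om S p Q w]))%E.
Proof.
elim: p jo jw O b W T => [c|x q IH|x q IH] jo jw O b W T /=.
- move=> _ uO uW sT _ _; rewrite /prob /=; case: (Q c).
    rewrite mulr1; apply: le_trans (cyl_ge b uO uW sT) _.
    by rewrite le_eqVlt (_ : _ `&` _ = cyl O b W T) ?eqxx // setIidl.
  by rewrite mulr0 measure_ge0.
- move=> [jx wq] uO uW sT dO dW.
  have xO : x \notin O by apply: contraL jx; exact: dO.
  have -> : cyl_weight O b W * prob r H (AskO x q) Q =
     bern true * cyl_weight O b W * prob r H (q true) Q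
     + bern false * cyl_weight O b W * prob r H (q false) Q.
    by rewrite /prob /bern /=; ring.
  apply: (@ask_om_le x O b W T (fun a => [set w | sem H om S (q a) Q w])
    (fun a => bern a * cyl_weight O b W * prob r H (q a) Q)) => //.
  + by move=> a; exact: measurable_sem.
  + by apply: measurableI; [exact: measurable_cyl|exact: (measurable_sem (AskO x q))].
  + move=> a; rewrite -(cyl_weight_consO b W a xO).
    apply: (IH a _ jw _ _ _ _ (wq a)) => //=; first by rewrite xO.
    move=> y; rewrite inE => /orP[/eqP ->|/dO/negPf ->] //.
    by rewrite eqxx andbF.
  + by move=> a w [[hx hc] ha]; split=> //=; rewrite hx.
- move=> [jx wq] uO uW sT dO dW.
  have xW : x \notin W by apply: contraL jx; exact: dW.
  have -> : cyl_weight O b W * prob r H (AskW x q) Q =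
     \sum_(t <- words step H) path_weight * cyl_weight O b W * prob r H (q t) Q.
    rewrite /prob /= walk_exp_words mulr_sumr; apply: eq_bigr => t _.
    by rewrite /path_weight; ring.
  apply: (@ask_walk_le x O b W T (fun a => [set w | sem H om S (q a) Q w])) => //.
  + by move=> a; exact: measurable_sem.
  + by apply: measurableI; [exact: measurable_cyl|exact: (measurable_sem (AskW x q))].
  + move=> t st; rewrite -(cyl_weight_consW O b W x).
    apply: (IH t jo _ _ _ _ _ (wq t)) => //=; first by rewrite xW.
      by move=> y; case: ifP.
    move=> y; rewrite inE => /orP[/eqP ->|/dW/negPf ->] //.
    by rewrite eqxx andbF.
  + move=> t st w [[hx hc] ha]; split=> //=; exists t; split=> //; split=> // k.
    by rewrite st; exact: hx.
Qed.

Lemma prob_le_sem B (p : prog d B) (Q : B -> bool) jo jw : within p jo jw ->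
  ((prob r H p Q)%:E <= P [set w | sem H om S p Q w])%E.
Proof.
have [t0 st0] : exists t0 : seq step, size t0 = H.
  by exists (nseq H (Ordinal d_gt0, true)); rewrite size_nseq.
move=> wp; have := @val_le_cyl B p Q jo jw [::] (fun=> true) [::] (fun=> t0) wp isT isT
  (fun=> st0).
rewrite /cyl_weight big_nil /= expr0 !mul1r => h.
apply: le_trans (h _ _) _ => //.
have mS := measurable_sem p Q.
apply: le_measure; last by move=> w [].
- by rewrite inE; apply: measurableI => //; exact: measurable_cyl.
- by rewrite inE.
Qed.

End FrogLaw.

Section Leaves.
Variables (R : realType) (d : nat) (r : R) (H : nat).
Local Notation site := 'rV[int]_d.
Local Notation step := ('I_d * bool)%type.
Hypothesis r01 : 0 <= r <= 1.

Fixpoint leaves (B : Type) (p : prog d B) (Q : B -> Prop) : Prop :=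
  match p with
  | Ret b => Q b
  | AskO x q => forall c, leaves (q c) Q
  | AskW x q => forall t, leaves (q t) Q
  end.

Lemma leaves_sub B (p : prog d B) (Q Q' : B -> Prop) :
  (forall b, Q b -> Q' b) -> leaves p Q -> leaves p Q'.
Proof. by move=> QQ; elim: p => [b|x q IH|x q IH] /= => [/QQ|h c|h c] //; exact: IH. Qed.

Lemma leaves_bind B C (p : prog d B) (k : B -> prog d C) Q :
  leaves p (fun b => leaves (k b) Q) -> leaves (bind p k) Q.
Proof. by elim: p => [b|x q IH|x q IH] //= h c; exact: IH. Qed.

Lemma leaves_holds Omega om S B (p : prog d B) Q (w : Omega) :
  leaves p Q -> holds H om S p Q w.
Proof.
by elim: p => [b|x q IH|x q IH] //= h => [|t _ _]; exact: IH.
Qed.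

Lemma holds_and Omega om S B (p : prog d B) Q Q' (w : Omega) :
  holds H om S p Q w -> holds H om S p Q' w ->
  holds H om S p (fun b => Q b /\ Q' b) w.
Proof.
by elim: p => [b|x q IH|x q IH] //= h h'; [exact: IH|move=> t st ft; apply: IH; auto].
Qed.

Lemma le_val_leaves B (p : prog d B) (Q : B -> Prop) (f g : B -> R) :
  leaves p Q -> (forall b, Q b -> f b <= g b) -> val r H p f <= val r H p g.
Proof.
move=> lp fg; move: r01 lp => /andP[r0 r1].
elim: p => [b|x q IH|x q IH] /= lp; first exact: fg.
  by apply: lerD; apply: ler_wpM2l; rewrite ?subr_ge0 //; exact: IH.
by apply: le_walk_exp => [s|t _]; [exact: srw_ge0|exact: IH].
Qed.

End Leaves.

(** * Leaps and crossings *)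

Section Reach.
Variables (R : realType) (d : nat) (Omega : Type).
Local Notation site := 'rV[int]_d.
Variables (om : site -> Omega -> bool) (S : site -> nat -> Omega -> site).
Implicit Types (x y : site) (w : Omega).

Definition reached w y (s : nat) : Prop :=
  om y w /\ (exists2 q, last 0 q = y & (path_cost R om S 0 q w <= s%:R%:E)%E).

Lemma reached0 w : om 0 w -> reached w 0 0.
Proof. by move=> o0; split=> //; exists [::]. Qed.

Lemma path_cost_rcons x q y w :
  path_cost R om S x (rcons q y) w = (path_cost R om S x q w + tau R om S (last x q) y w)%E.
Proof. by elim: q x => [|z q IH] x /=; rewrite ?adde0 ?add0e // IH addeA. Qed.

Lemma tau_le x y k w : om x w -> S x k w = y -> (tau R om S x y w <= k%:R%:E)%E.
Proof. by move=> ox Sy; rewrite /tau ox; apply: ereal_inf_lbound; exists k. Qed.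

(** The occupation of [y] is left open, as required by the final hit of the target. *)
Lemma reached_cost w x s k y : reached w x s -> S x k w = y ->
  exists2 q, last 0 q = y & (path_cost R om S 0 q w <= (s + k)%:R%:E)%E.
Proof.
move=> [ox [q lq cq]] Sy; exists (rcons q y); first by rewrite last_rcons.
by rewrite path_cost_rcons natrD EFinD lq leeD // tau_le.
Qed.

Lemma reached_le w y s s' : (s <= s')%N -> reached w y s -> reached w y s'.
Proof.
move=> ss [oy [q lq cq]]; split=> //; exists q => //.
by apply: le_trans cq _; rewrite lee_fin ler_nat.
Qed.

Lemma reached_step w x s k s' y : reached w x s -> S x k w = y -> om y w ->
  (s + k <= s')%N -> reached w y s'.
Proof.
move=> rx Sy oy ss; apply: (reached_le ss); split=> //.
exact: reached_cost rx Sy.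
Qed.

End Reach.

(** * Leaps from a set of awake frogs to a cube *)

Section Jump.
Variables (R : realType) (d : nat) (r : R) (H : nat).
Local Notation site := 'rV[int]_d.
Local Notation step := ('I_d * bool)%type.
Hypothesis r01 : 0 <= r <= 1.
Hypothesis d_gt0 : (0 < d)%N.
Implicit Types (x y : site) (A U V L : seq site).

Fixpoint scan L U : prog d (seq site) :=
  if U is u :: U' then AskO u (fun c => scan (if c then u :: L else L) U') else Ret d L.

Variables (V : seq site) (T : nat) (h : R).

Definition found x (t : seq step) : seq site := [seq v <- V | v \in traj x (take T t)].

(** The frogs are tried in turn until one walk meets at least [h] sites of [V]. Occupations are
    revealed along that walk only, hence they are still fresh when it is chosen. *)
Fixpoint jump A : prog d (seq site) :=
  if A is a :: A' then
    AskW a (fun t => if h <= (size (found a t))%:R then scan [::] (found a t) else jump A')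
  else Ret d [::].

Lemma within_scan L U (jo jw : pred site) : uniq U -> {subset U <= jo} ->
  within (scan L U) jo jw.
Proof.
elim: U L jo => //= u U IH L jo /andP[uU uniU] sub; split; first by apply: sub; rewrite mem_head.
move=> c; apply: IH => // v vU; rewrite unfold_in; apply/andP; split.
  by apply: sub; rewrite inE vU orbT.
by apply: contraNneq uU => <-.
Qed.

Lemma leaves_scan L U : uniq (L ++ U) ->
  leaves (scan L U) (fun L' => uniq L' /\ {subset L' <= L ++ U}).
Proof.
elim: U L => [|u U IH] L; first by rewrite cats0 => uL; split.
move=> uLU c; move: c.
case=> /=.
  have e : perm_eq ((u :: L) ++ U) (L ++ u :: U) by apply/permP => a; rewrite !count_cat /= -addnA addnCA.
  apply: leaves_sub (IH (u :: L) _); last by rewrite (perm_uniq e).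
  by move=> L' [uL' sub]; split=> // y /sub; rewrite (perm_mem e).
apply: leaves_sub (IH L _).
  move=> L' [uL' sub]; split=> // y /sub; rewrite !mem_cat inE.
  by case/orP => ->; rewrite ?orbT.
by move: uLU; rewrite !cat_uniq /= negb_or => /and3P[-> /andP[_ ->] /andP[_ ->]].
Qed.

Lemma holds_scan Omega (om : site -> Omega -> bool) S (w : Omega) L U : (forall y, y \in L -> om y w) ->
  holds H om S (scan L U) (fun L' => forall y, y \in L' -> om y w) w.
Proof.
elim: U L => [|u U IH] L //= oL; apply: IH => y.
case ou: (om u w); last exact: oL.
by rewrite inE => /orP[/eqP->|/oL].
Qed.

Lemma val_scan L U :
  val r H (scan L U) (fun L' => 2^-1 ^+ size L') = 2^-1 ^+ size L * (1 - r / 2) ^+ size U.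
Proof.
elim: U L => [|u U IH] L /=; first by rewrite expr0 mulr1.
by rewrite !IH /= !exprS; field.
Qed.

(** Chernoff bound with the generating function of a binomial variable at 1/2, then
    [1 - r / 2 <= expR (- (r / 2))]. *)
Lemma prob_scan_lt U m : prob r H (scan [::] U) (fun L => (size L < m)%N)
  <= 2 ^+ m * expR (- (r * (size U)%:R / 2)).
Proof.
have half0 : 0 <= 2^-1 :> R by [].
have half1 : 2^-1 <= 1 :> R by lra.
apply: (@le_trans _ _ (val r H (scan [::] U) (fun L => 2 ^+ m * 2^-1 ^+ size L))).
  apply: le_val => // L; case: (ltnP (size L) m) => hm; last by rewrite mulr_ge0 ?exprn_ge0.
  rewrite -(ler_pM2r (_ : 0 < 2^-1 ^+ m)) ?exprn_gt0 // mul1r mulrAC -exprMn.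
  rewrite mulfV // expr1n mul1r; apply: ler_wiXn2l => //; exact: ltnW.
rewrite valZ val_scan expr0 mul1r; apply: ler_wpM2l; first by rewrite exprn_ge0.
rewrite (_ : - (r * (size U)%:R / 2) = (size U)%:R * (- (r / 2))); last by ring.
rewrite expRM_natl; apply: lerXn2r; rewrite ?nnegrE ?expR_ge0 //.
  by move: r01 => /andP[]; lra.
exact: expR_ge1Dx.
Qed.

Lemma within_jump A (jo jw : pred site) : uniq A -> uniq V ->
  {subset A <= jw} -> {subset V <= jo} -> within (jump A) jo jw.
Proof.
elim: A jw => //= a A IH jw /andP[aA uA] uV sA sV; split; first by apply: sA; rewrite mem_head.
move=> t; case: ifP => _.
  apply: within_scan; first exact: filter_uniq.
  by move=> v; rewrite mem_filter => /andP[_ /sV].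
apply: IH => // v vA; rewrite unfold_in; apply/andP; split.
  by apply: sA; rewrite inE vA orbT.
by apply: contraNneq aA => <-.
Qed.

Lemma leaves_jump A : uniq V -> leaves (jump A) (fun L => uniq L /\ {subset L <= V}).
Proof.
move=> uV; elim: A => //= a A IH t; case: ifP => // _.
have := @leaves_scan [::] (found a t) (filter_uniq _ uV).
by apply: leaves_sub => L [uL sub]; split=> // v /sub; rewrite mem_filter => /andP[].
Qed.

Lemma holds_jump Omega (om : site -> Omega -> bool) S (w : Omega) A s : (T <= H)%N -> uniq V ->
  {in A, forall a, reached R om S w a s} ->
  holds H om S (jump A) (fun L => {in L, forall y, reached R om S w y (s + T)}) w.
Proof.
move=> TH uV; elim: A => //= a A IH rA t st ft; case: ifP => _; last first.
  by apply: IH => b bA; apply: rA; rewrite inE bA orbT.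
have h1 := leaves_holds H om S w (@leaves_scan [::] (found a t) (filter_uniq _ uV)).
have h2 := @holds_scan Omega om S w [::] (found a t) (fun y (H : y \in [::]) => False_ind _ (notF H)).
apply: holds_sub (holds_and h1 h2) => L [[uL sub] oL] y yL.
have := sub y yL; rewrite mem_filter => /andP[/mem_trajP[k kT yk] _].
have kT' : (k <= T)%N by apply: leq_trans kT _; rewrite size_take_min geq_minl.
apply: (@reached_step _ _ _ om S w a s k) => //; first by apply: rA; rewrite mem_head.
- by rewrite ft ?st; [rewrite -yk take_takel|exact: leq_trans TH].
- exact: oL.
- by rewrite leq_add2l.
Qed.

(** Either all walks fail, or the first successful one meets too few frogs. The second error is paid
    once, since one walk at most is scanned. *)
Lemma prob_jump_lt (p : R) A m : (T <= H)%N -> 0 <= p <= 1 ->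
  {in A, forall a, p <= walk_exp (@srw R d) T (fun t =>
     ((h <= (size [seq v <- V | v \in traj a t])%:R)%R)%:R)} ->
  prob r H (jump A) (fun L => (size L < m)%N)
    <= (1 - p) ^+ size A + 2 ^+ m * expR (- (r * h / 2)).
Proof.
move=> TH /andP[p0 p1] pA; set e := 2 ^+ m * _.
have e0 : 0 <= e by rewrite mulr_ge0 ?expR_ge0 ?exprn_ge0.
elim: A pA => [|a A IH] pA /=.
  by rewrite expr0; apply: le_trans (prob_le1 _ _ _ _ _) _ => //; rewrite lerDl.
have {}IH : prob r H (jump A) (fun L => (size L < m)%N) <= (1 - p) ^+ size A + e.
  by apply: IH => b bA; apply: pA; rewrite inE bA orbT.
have pa := pA a (mem_head _ _).
set q := (1 - p) ^+ size A in IH.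
have q0 : 0 <= q by rewrite exprn_ge0 // subr_ge0.
rewrite /prob /=.
pose good (t : seq step) : R := ((h <= (size (found a t))%:R)%R)%:R.
apply: (@le_trans _ _ (walk_exp (@srw R d) H (fun t => (e + q) + (- q) * good t))).
  apply: le_walk_exp => [s|t _]; first exact: srw_ge0.
  rewrite /good; case: ifP => [hf|_]; last by rewrite mulr0 addr0 addrC.
  rewrite mulr1 addrK; apply: le_trans (prob_scan_lt _ _) _.
  apply: ler_wpM2l; first by rewrite exprn_ge0.
  rewrite ler_expR lerN2 ler_pM2r // ler_wpM2l //.
  by move: r01 => /andP[].
rewrite walk_expD walk_expZ (walk_exp_cst (srw_sum1 R d_gt0)).
rewrite /good /found (walk_exp_take (srw_sum1 R d_gt0) (fun t =>
  ((h <= (size [seq v <- V | v \in traj a t])%:R)%R)%:R) TH).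
rewrite exprS -/q; nra.
Qed.

End Jump.

(** * Composition of stages *)

Section Stage.
Variables (R : realType) (d : nat) (r : R) (H : nat).
Local Notation site := 'rV[int]_d.
Hypothesis r01 : 0 <= r <= 1.
Hypothesis d_gt0 : (0 < d)%N.
Implicit Types (A B C L : seq site) (jo jw tgt : pred site).

(** Disjoint permitted sets for [p] and for its continuation exclude repeated queries. *)
Lemma within_bind_leaves (B C : Type) (p : prog d B) (k : B -> prog d C) Q jo jw jo' jw' :
  (forall x, jo x -> ~~ jo' x) -> (forall x, jw x -> ~~ jw' x) ->
  leaves p Q -> within p jo jw -> (forall b, Q b -> within (k b) jo' jw') ->
  within (bind p k) (fun x => jo x || jo' x) (fun x => jw x || jw' x).
Proof.
elim: p jo jw => [b|x q IH|x q IH] jo jw dio diw /= lq.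
- by move=> _ wk; apply: within_sub (wk b lq) => x ->; rewrite orbT.
- move=> [jx wq] wk; split; first by rewrite jx.
  move=> c; apply: within_sub (IH c _ jw _ diw (lq c) (wq c) wk) => // y.
    case/orP => [/andP[-> ->] //|jy]; rewrite jy orbT /=.
    by apply: contraTneq jy => ->; exact: dio.
  by move=> /andP[/dio].
- move=> [jx wq] wk; split; first by rewrite jx.
  move=> c; apply: within_sub (IH c jo _ dio _ (lq c) (wq c) wk) => // y.
    case/orP => [/andP[-> ->] //|jy]; rewrite jy orbT /=.
    by apply: contraTneq jy => ->; exact: diw.
  by move=> /andP[/diw].
Qed.

(** A union bound over the two phases, [g'] being the failure event. *)
Lemma prob_bind_leaves (B C : Type) (p : prog d B) (k : B -> prog d C) Q g g' (a c : R) : 0 <= c ->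
  leaves p Q -> prob r H p (fun b => ~~ g b) <= a ->
  (forall b, Q b -> g b -> prob r H (k b) g' <= c) ->
  prob r H (bind p k) g' <= a + c.
Proof.
move=> c0 lp ap ck; apply: le_trans (lerD ap (lexx c)).
rewrite -(val_cst r H d_gt0 p c) -valD /prob val_bind.
apply: (le_val_leaves H r01 lp) => b Qb.
case: (boolP (g b)) => [/(ck b Qb)|_]; first by rewrite add0r.
by apply: le_trans (prob_le1 _ _ _ _ _) _ => //; rewrite lerDl.
Qed.

Lemma prob_bind_ge_leaves (B C : Type) (p : prog d B) (k : B -> prog d C) Q g g' (a c : R) :
  0 <= c -> leaves p Q -> a <= prob r H p g ->
  (forall b, Q b -> g b -> c <= prob r H (k b) g') ->
  a * c <= prob r H (bind p k) g'.
Proof.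
move=> c0 lp ap ck; apply: le_trans (ler_wpM2r c0 ap) _.
rewrite mulrC -valZ /prob val_bind; apply: (le_val_leaves H r01 lp) => b Qb.
case: (boolP (g b)) => [/(ck b Qb)|_]; first by rewrite mulr1.
by rewrite mulr0; exact: prob_ge0.
Qed.

(* [jo] and [jw] bound the occupations and the walks that [p] may reveal. *)
Definition stage A (p : prog d (seq site)) jo jw tgt (t : nat) : Prop :=
  [/\ within p jo jw,
      leaves p (fun L => uniq L /\ {subset L <= tgt}) &
      forall (Omega : Type) (om : site -> Omega -> bool) S w s,
        {in A, forall a, reached R om S w a s} ->
        holds H om S p (fun L => {in L, forall y, reached R om S w y (s + t)}) w].

Lemma stage_sub A A' p jo jw tgt t jo' jw' tgt' :
  {subset A' <= A} -> (forall x, jo x -> jo' x) -> (forall x, jw x -> jw' x) ->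
  (forall x, tgt x -> tgt' x) ->
  stage A' p jo jw tgt t -> stage A p jo' jw' tgt' t.
Proof.
move=> sA so sw st [pw pl ph]; split.
- exact: within_sub pw.
- by apply: leaves_sub pl => L [uL sL]; split=> // x /sL; exact: st.
- by move=> Omega om S w s rA; apply: ph => a /sA; exact: rA.
Qed.

Lemma stage_src A A' p jo jw tgt t : {subset A' <= A} ->
  stage A' p jo jw tgt t -> stage A p jo jw tgt t.
Proof. by move=> sA; apply: stage_sub. Qed.

Lemma stage_ret A jo jw tgt : uniq A -> {subset A <= tgt} -> stage A (Ret d A) jo jw tgt 0.
Proof. by move=> uA sA; split=> // Omega om S w s; rewrite addn0. Qed.

Lemma stage_bind A p k jo jw tgt t jo' jw' tgt' t' :
  (forall x, jo x -> ~~ jo' x) -> (forall x, jw x -> ~~ jw' x) ->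
  stage A p jo jw tgt t ->
  (forall B, uniq B -> {subset B <= tgt} -> stage B (k B) jo' jw' tgt' t') ->
  stage A (bind p k) (fun x => jo x || jo' x) (fun x => jw x || jw' x) tgt' (t + t').
Proof.
move=> dio diw [pw pl ph] sk; split.
- by apply: (within_bind_leaves dio diw pl pw) => B [uB sB]; case: (sk B uB sB).
- by apply: leaves_bind; apply: leaves_sub pl => B [uB sB]; case: (sk B uB sB).
- move=> Omega om S w s rA; apply: holds_bind.
  apply: holds_sub (holds_and (leaves_holds H om S w pl) (ph _ _ _ _ _ rA)).
  move=> B [[uB sB] rB]; case: (sk B uB sB) => _ _ /(_ _ _ _ _ _ rB).
  by rewrite addnA.
Qed.

(** Both programs are run in all cases, so that their failures are independent and their
    probabilities multiply. They start at the same time, hence the duration is counted once. *)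
Definition choice (n : nat) (p q : prog d (seq site)) : prog d (seq site) :=
  bind p (fun C => bind q (fun D => Ret d (if (n <= size C)%N then C else D))).

Lemma stage_choice n A p q jo jw tgt jo' jw' tgt' t :
  (forall x, jo x -> ~~ jo' x) -> (forall x, jw x -> ~~ jw' x) ->
  stage A p jo jw tgt t -> stage A q jo' jw' tgt' t ->
  stage A (choice n p q) (fun x => jo x || jo' x) (fun x => jw x || jw' x)
    (fun x => tgt x || tgt' x) t.
Proof.
move=> dio diw [pw pl ph] [qw ql qh]; split.
- apply: (within_bind_leaves dio diw pl pw) => C _.
  have := @within_bind_leaves _ _ q (fun D => Ret d (if (n <= size C)%N then C else D))
    _ jo' jw' pred0 pred0 _ _ ql qw (fun _ _ => I).
  by move=> h; apply: within_sub (h _ _) => // x; rewrite orbF.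
- apply: leaves_bind; apply: leaves_sub pl => C [uC sC].
  apply: leaves_bind; apply: leaves_sub ql => D [uD sD] /=.
  case: ifP => _; split=> // x.
    by move/sC; rewrite !unfold_in => ->.
  by move/sD; rewrite !unfold_in => ->; rewrite orbT.
- move=> Omega om S w s rA; apply: holds_bind.
  apply: holds_sub (ph _ _ _ _ _ rA) => C rC; apply: holds_bind.
  by apply: holds_sub (qh _ _ _ _ _ rA) => D rD /=; case: ifP.
Qed.

Lemma prob_choice n p q : prob r H (choice n p q) (fun L => (size L < n)%N)
  = prob r H p (fun L => (size L < n)%N) * prob r H q (fun L => (size L < n)%N).
Proof.
rewrite /choice [LHS]val_bind mulrC -valZ; apply: eq_val => // C.
rewrite val_bind /= mulrC -valZ; apply: eq_val => // D.
by case: (ltnP (size C) n) => hC; rewrite ?mul1r // mul0r ltnNge hC.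
Qed.

End Stage.

(** * Recursive crossings *)

Section Crossing.
Variables (R : realType) (d : nat) (r : R) (H : nat).
Local Notation site := 'rV[int]_d.
Hypothesis r01 : 0 <= r <= 1.
Hypothesis d_gt0 : (0 < d)%N.
Variables (i j : 'I_d).
Hypothesis ji : j != i.
Variables (rho m : nat) (h : nat -> R).
Implicit Types (x y z : site) (A B C L : seq site).

Definition radius k := (rho * 2 ^ k)%N.
Definition side k := (4 * radius k)%N.
Definition jtime k := (radius k ^ 2)%N.
Definition leap k z A := jump (cube_seq z (side k)) (jtime k) (h k) A.

Definition shift (c : 'I_d) (s : nat) z : site := z + delta_mx ord0 c *+ s.

Lemma shiftE c s z c' : (shift c s z) ord0 c' = z ord0 c' + (if c' == c then s%:Z else 0).
Proof.
by rewrite /shift mxE mulmxnE mxE eqxx /=; case: (c' == c); rewrite ?mulr0n ?mul0rn ?mulr1n ?natz.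
Qed.

Definition region z (a b : int) (l : nat) : pred site := fun x =>
  [forall c, if c == i then (z ord0 c + a <= x ord0 c) && (x ord0 c < z ord0 c + b)
             else (z ord0 c <= x ord0 c) && (x ord0 c < z ord0 c + l%:Z)].

Lemma sideS k : side k.+1 = (2 * side k)%N.
Proof. by rewrite /side /radius expnS; ring. Qed.

Lemma jtime_le k l : (k <= l)%N -> (jtime k <= jtime l)%N.
Proof. by move=> kl; rewrite leq_exp2r // leq_mul2l leq_exp2l // kl orbT. Qed.

Lemma regionP z a b l x : reflect (forall c,
  if c == i then z ord0 c + a <= x ord0 c < z ord0 c + b
  else z ord0 c <= x ord0 c < z ord0 c + l%:Z) (region z a b l x).
Proof. exact: forallP. Qed.

Lemma cubeP z l x : reflect (forall c, z ord0 c <= x ord0 c < z ord0 c + l%:Z) (cube z l x).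
Proof. exact: forallP. Qed.

Lemma region_sub z z' a b a' b' l l' x :
  z' ord0 i + a' <= z ord0 i + a -> z ord0 i + b <= z' ord0 i + b' ->
  (forall c, c != i -> z' ord0 c <= z ord0 c /\ z ord0 c + l%:Z <= z' ord0 c + l'%:Z) ->
  region z a b l x -> region z' a' b' l' x.
Proof.
move=> ha hb hc /regionP hx; apply/regionP => c; have := hx c.
case: (eqVneq c i) => [->|ci] /andP[h1 h2]; apply/andP; split.
- exact: le_trans h1.
- exact: lt_le_trans hb.
- by apply: le_trans h1; case: (hc c ci).
- by apply: lt_le_trans h2 _; case: (hc c ci).
Qed.

Lemma cube_region z l x : cube z l x = region z 0 l%:Z l x.
Proof.
by apply: eq_forallb => c; rewrite addr0; case: ifP.
Qed.

(** Starting points from which either of two lanes, lying side by side along [j], can be entered by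
    a leap of level [k]. *)
Definition source k z := region z (- (2 * side k)%:Z) 0 (2 * side k).

Lemma near_source k z x : source k z x -> near_cube (radius k) x z.
Proof.
clear r01 d_gt0 ji; move=> /regionP hx c; have := hx c; rewrite /side.
case: ifP => _; rewrite !PoszM; move: (x ord0 c) (z ord0 c) => a b; lia.
Qed.

Lemma near_source_lane k z x : source k z x -> near_cube (radius k) x (shift j (side k) z).
Proof.
clear r01 d_gt0; move=> /regionP hx c; have := hx c; rewrite shiftE /side.
case: (eqVneq c j) => [->|_]; rewrite ?(negPf ji); last case: ifP => _;
  rewrite !PoszM; move: (x ord0 _) (z ord0 _) => a b; lia.
Qed.

Lemma stage_leap k z A (jo jw tgt : pred site) : uniq A -> {subset A <= jw} ->
  (forall x, cube z (side k) x -> jo x) -> (forall x, cube z (side k) x -> tgt x) ->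
  (jtime k <= H)%N ->
  stage R H A (leap k z A) jo jw tgt (jtime k).
Proof.
move=> uA sA so st TH; split.
- apply: within_jump => //; first exact: cube_seq_uniq.
  by move=> x; rewrite mem_cube_seq; exact: so.
- apply: leaves_sub (leaves_jump (jtime k) (h k) A (cube_seq_uniq z (side k))).
  by move=> L [uL sL]; split=> // x /sL; rewrite mem_cube_seq; exact: st.
- by move=> Omega om S w s rA; apply: holds_jump => //; exact: cube_seq_uniq.
Qed.

Variables (eps : nat -> R) (q : R).
Hypothesis rho_gt0 : (0 < rho)%N.
Hypothesis leap_fail : forall k z A, (jtime k <= H)%N -> (m * 2 ^ k <= size A)%N ->
  {in A, forall a, near_cube (radius k) a z} ->
  prob r H (leap k z A) (fun L => (size L < 4 * (m * 2 ^ k))%N) <= eps k.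
Hypothesis eps_q : forall k, 0 <= eps k /\ 8 * (eps k + q) ^+ 2 + eps k <= q.
Hypothesis q_ge0 : 0 <= q.

Definition pop k := (m * 2 ^ k)%N.

(** The term [2 * side k'] is the extent of the starting cube of the upper level; each segment
    consists of a crossing and of its landing cube. *)
Fixpoint len k : nat := if k is k'.+1 then 2 * side k' + 8 * (len k' + side k') else side 0.
Fixpoint ctime k : nat := if k is k'.+1 then 8 * (jtime k' + ctime k') + jtime k' else jtime 0.

Definition lane (cr : site -> seq site -> prog d (seq site)) k z A :=
  bind (leap k z A) (cr z).

(** The frogs are shared between the lanes so that no walk is used twice; together the lanes have
    width [side k.+1]. *)
Definition segment cr k z A :=
  choice (2 * pop k) (lane cr k z (take (pop k) A))
    (lane cr k (shift j (side k) z) (drop (pop k) A)).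

Definition seg_pos k n := (2 * side k + n * (len k + side k))%N.

Fixpoint segments cr k n z A :=
  if n is n'.+1 then
    bind (segments cr k n' z A) (segment cr k (shift i (seg_pos k n') z))
  else Ret d A.

(** The segments deliver [2 * pop k'] frogs, in either lane. The last leap brings the crossing back
    to the first lane and raises their number to [4 * pop k'], which is [2 * pop k'.+1]. *)
Fixpoint cross k z A :=
  if k is k'.+1 then
    bind (segments (cross k') k' 8 z A) (leap k' (shift i (len k'.+1) z))
  else leap 0 (shift i (len 0) z) A.

(** Occupations are asked only beyond the starting cube, and walks only before the arrival cube;
    successive crossings can then be chained without asking anything twice. *)
Definition cross_stage k := forall z A, uniq A -> {subset A <= cube z (side k)} ->
  stage R H A (cross k z A)
    (region z (side k) (len k + side k)%N (side k))
    (region z 0 (len k) (side k))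
    (cube (shift i (len k) z) (side k)) (ctime k).

Lemma stage_lane k z A (jw : pred site) :
  (jtime k <= H)%N -> cross_stage k -> uniq A -> {subset A <= jw} ->
  (forall x, jw x -> ~~ region z 0 (len k) (side k) x) ->
  stage R H A (lane (cross k) k z A)
    (region z 0 (len k + side k)%N (side k))
    (fun x => jw x || region z 0 (len k) (side k) x)
    (cube (shift i (len k) z) (side k)) (jtime k + ctime k).
Proof.
move=> TH IH uA sA djw.
have : stage R H A (lane (cross k) k z A)
  (fun x => region z 0 (side k) (side k) x || region z (side k) (len k + side k)%N (side k) x)
  (fun x => jw x || region z 0 (len k) (side k) x)
  (cube (shift i (len k) z) (side k)) (jtime k + ctime k).
  apply: (@stage_bind _ _ _ _ _ _ _ _ (cube z (side k))) => //.
  - move=> x /regionP /(_ i); rewrite eqxx => /andP[_ h1].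
    by apply/regionP => /(_ i); rewrite eqxx leNgt h1.
  - apply: stage_leap => // x; first by rewrite cube_region.
  - exact: IH.
clear r01 d_gt0 ji rho_gt0 q_ge0.
apply: stage_sub => // x; case/orP; apply: region_sub => //; lia.
Qed.

Lemma seg_posS k n : seg_pos k n.+1 = (seg_pos k n + len k + side k)%N.
Proof. by rewrite /seg_pos [(n.+1 * _)%N]mulSnr -!addnA. Qed.

Lemma lenS k : len k.+1 = seg_pos k 8.
Proof. by []. Qed.

(* After [n] segments, no walk started beyond [seg_start k n] has been revealed. *)
Definition seg_start k n := if n is n'.+1 then (seg_pos k n' + len k)%N else 0%N.

Lemma seg_start_pos k n : (seg_start k n <= seg_pos k n <= seg_start k n + 2 * side k)%N.
Proof.
clear r01 d_gt0 ji rho_gt0 q_ge0.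
by case: n => [|n]; rewrite /seg_start ?seg_posS /seg_pos; lia.
Qed.

Lemma stage_segment k n z A : (jtime k <= H)%N -> cross_stage k -> uniq A ->
  {subset A <= region z (seg_start k n) (seg_pos k n) (2 * side k)} ->
  stage R H A (segment (cross k) k (shift i (seg_pos k n) z) A)
    (region z (seg_pos k n) (seg_pos k n.+1) (2 * side k))
    (region z (seg_start k n) (seg_start k n.+1) (2 * side k))
    (region z (seg_start k n.+1) (seg_pos k n.+1) (2 * side k)) (jtime k + ctime k).
Proof.
move=> TH IH uA sA; clear r01 d_gt0 rho_gt0 q_ge0.
have /andP[b1 b2] := seg_start_pos k n.
have ps := seg_posS k n; have ss : seg_start k n.+1 = (seg_pos k n + len k)%N by [].
move: (seg_pos k n) (seg_pos k n.+1) (seg_start k n) (seg_start k n.+1) b1 b2 ps ss sA.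
move=> a a' b b' b1 b2 ps ss sA.
set z0 := shift i a z; set z1 := shift j (side k) z0.
have z0i : z0 ord0 i = z ord0 i + a%:Z by rewrite shiftE eqxx.
have z1i : z1 ord0 i = z ord0 i + a%:Z by rewrite shiftE z0i eq_sym (negPf ji) addr0.
have z0c c : c != i -> z0 ord0 c = z ord0 c by move=> ci; rewrite shiftE (negPf ci) addr0.
have z1c c : c != i -> z1 ord0 c = z ord0 c + (if c == j then (side k)%:Z else 0).
  by move=> ci; rewrite shiftE z0c.
set A0 := take (pop k) A; set A1 := drop (pop k) A.
have uA01 : uniq (A0 ++ A1) by rewrite cat_take_drop.
have [uA0 dis uA1] : [/\ uniq A0, ~~ has (mem A0) A1 & uniq A1].
  by apply/and3P; rewrite -cat_uniq.
have sA0 : {subset A0 <= A} by move=> x; exact: mem_take.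
have sA1 : {subset A1 <= A} by move=> x; exact: mem_drop.
(* The frogs of [A] lie in front of both lanes, so their walks are not among those revealed inside
   the lanes. *)
have lane_jw y x : y ord0 i = z ord0 i + a%:Z -> x \in A -> ~~ region y 0 (len k) (side k) x.
  move=> yi xA; apply/regionP => /(_ i); rewrite eqxx yi addr0 => /andP[h1 _].
  have /regionP /(_ i) := sA x xA; rewrite eqxx => /andP[_].
  by rewrite ltNge h1.
have st0 := @stage_lane k z0 A0 (mem A0) TH IH uA0 (fun x xA => xA)
   (fun x xA => lane_jw z0 x z0i (sA0 x xA)).
have st1 := @stage_lane k z1 A1 (mem A1) TH IH uA1 (fun x xA => xA)
   (fun x xA => lane_jw z1 x z1i (sA1 x xA)).
(* The two lanes are separated in direction [j]. *)
have apart a1 a2 a3 a4 x : region z0 a1 a2 (side k) x -> ~~ region z1 a3 a4 (side k) x.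
  move=> /regionP /(_ j); rewrite (negPf ji) => /andP[_ h1].
  apply/regionP => /(_ j); rewrite (negPf ji) z1c // eqxx -z0c // => /andP[h2 _].
  by rewrite ltNge h2 in h1.
have {}st0 := stage_src sA0 st0.
have {}st1 := stage_src sA1 st1.
apply: (stage_sub _ _ _ _ (stage_choice (2 * pop k) _ _ st0 st1)) => //.
- move=> x /orP[]; apply: region_sub; rewrite ?z0i ?z1i; try (clear - b1 b2 ps ss; lia).
    by move=> c ci; rewrite z0c //; clear; lia.
  by move=> c ci; rewrite z1c //; case: ifP; clear; lia.
- move=> x /orP[] /orP[].
  + move=> xA; have := sA x (sA0 x xA); apply: region_sub; clear - b1 b2 ps ss; lia.
  + apply: region_sub; rewrite ?z0i; try (clear - b1 b2 ps ss; lia).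
    by move=> c ci; rewrite z0c //; clear; lia.
  + move=> xA; have := sA x (sA1 x xA); apply: region_sub; clear - b1 b2 ps ss; lia.
  + apply: region_sub; rewrite ?z1i; try (clear - b1 b2 ps ss; lia).
    by move=> c ci; rewrite z1c //; case: ifP; clear; lia.
- move=> x /orP[]; rewrite cube_region; apply: region_sub;
    rewrite ?shiftE ?eqxx ?(negPf ji) ?(eq_sym i) ?(negPf ji) ?z0i ?z1i; try (clear - b1 b2 ps ss; lia).
    by move=> c ci; rewrite shiftE (negPf ci) z0c //; clear; lia.
  by move=> c ci; rewrite shiftE (negPf ci) z1c //; case: ifP; clear; lia.
- by move=> x; exact: apart.
- move=> x /orP[xA|hx]; apply/negP => /orP[xA'|hx'].
  + by move/hasP: dis; apply; exists x.
  + by have := lane_jw z1 x z1i (sA0 x xA); rewrite hx'.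
  + by have := lane_jw z0 x z0i (sA1 x xA'); rewrite hx.
  + by have := apart _ _ 0 (len k) _ hx; rewrite hx'.
Qed.

Lemma stage_segments k n z A : (jtime k <= H)%N -> cross_stage k -> uniq A ->
  {subset A <= cube z (2 * side k)} ->
  stage R H A (segments (cross k) k n z A)
    (region z (2 * side k) (seg_pos k n) (2 * side k))
    (region z 0 (seg_start k n) (2 * side k))
    (region z (seg_start k n) (seg_pos k n) (2 * side k)) (n * (jtime k + ctime k)).
Proof.
move=> TH IH uA sA; elim: n => [|n IHn] /=.
  apply: stage_ret => // x /sA; rewrite -[x \in cube _ _]/(cube _ _ x) cube_region.
  by rewrite /seg_pos mul0n addn0.
rewrite [(n.+1 * _)%N]mulSnr.
have := stage_bind _ _ IHn (fun B uB sB => stage_segment TH IH uB sB).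
have /andP[b1 b2] := seg_start_pos k n.
have ps := seg_posS k n; have ss : seg_start k n.+1 = (seg_pos k n + len k)%N by [].
clear r01 d_gt0 rho_gt0 q_ge0 IHn.
have p2 : (2 * side k <= seg_pos k n)%N by exact: leq_addr.
move=> h0; apply: (stage_sub _ _ _ _ (h0 _ _)) => //.
- by move=> x /orP[]; apply: region_sub; lia.
- by move=> x /orP[]; apply: region_sub; lia.
- move=> x /regionP /(_ i); rewrite eqxx => /andP[_ h1].
  by apply/regionP => /(_ i); rewrite eqxx leNgt h1.
- move=> x /regionP /(_ i); rewrite eqxx => /andP[_ h1].
  by apply/regionP => /(_ i); rewrite eqxx leNgt h1.
Qed.

Lemma stage_cross k : (jtime k <= H)%N -> cross_stage k.
Proof.
clear r01 d_gt0 rho_gt0 q_ge0; elim: k => [|k IH] TH z A uA sA.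
  apply: stage_leap => //; first by move=> x /sA; rewrite -[x \in cube _ _]/(cube _ _ x) cube_region.
  move=> x; rewrite cube_region; apply: region_sub; rewrite ?shiftE ?eqxx /=; try lia.
  by move=> c ci; rewrite shiftE (negPf ci); lia.
have TH' : (jtime k <= H)%N by apply: leq_trans TH; exact: jtime_le.
have {}IH := IH TH'.
rewrite /= -/(len k.+1) lenS.
have sA' : {subset A <= cube z (2 * side k)} by rewrite -sideS.
have st := stage_segments 8 TH' IH uA sA'.
have p2 : (2 * side k <= seg_pos k 8)%N by exact: leq_addr.
have /andP[b1 b2] := seg_start_pos k 8.
rewrite sideS.
have so x : cube (shift i (seg_pos k 8) z) (side k) x ->
    region z (seg_pos k 8) (seg_pos k 8 + side k)%N (2 * side k) x.
  rewrite cube_region; apply: region_sub; rewrite ?shiftE ?eqxx; try lia.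
  by move=> c ci; rewrite shiftE (negPf ci); lia.
have stt x : cube (shift i (seg_pos k 8) z) (side k) x ->
    cube (shift i (seg_pos k 8) z) (2 * side k) x.
  by rewrite !cube_region; apply: region_sub; lia.
have h0 := stage_bind _ _ st (fun B uB sB => stage_leap uB sB so stt TH').
apply: (stage_sub _ _ _ _ (h0 _ _)) => //.
- by move=> x /orP[]; apply: region_sub; lia.
- by move=> x /orP[]; apply: region_sub; lia.
- move=> x /regionP /(_ i); rewrite eqxx => /andP[_ h1].
  by apply/regionP => /(_ i); rewrite eqxx leNgt h1.
- move=> x /regionP /(_ i); rewrite eqxx => /andP[_ h1].
  by apply/regionP => /(_ i); rewrite eqxx leNgt h1.
Qed.

Definition cross_prob k := forall z A, uniq A -> {subset A <= cube z (side k)} ->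
  (pop k <= size A)%N ->
  prob r H (cross k z A) (fun L => (size L < 2 * pop k)%N) <= q.

Lemma prob_lane k z A : (jtime k <= H)%N -> cross_prob k ->
  {in A, forall a, near_cube (radius k) a z} -> (pop k <= size A)%N ->
  prob r H (lane (cross k) k z A) (fun L => (size L < 2 * pop k)%N) <= eps k + q.
Proof.
move=> TH IH nA sA.
apply: (@prob_bind_leaves _ _ _ _ r01 d_gt0 _ _ _ _
  (fun L => uniq L /\ {subset L <= cube z (side k)}) (fun L => (pop k <= size L)%N)) => //.
- apply: leaves_sub (leaves_jump (jtime k) (h k) A (cube_seq_uniq z (side k))).
  by move=> L [uL sL]; split=> // x /sL; rewrite mem_cube_seq.
- apply: le_trans (leap_fail TH sA nA); apply: prob_sub => // L.
  by rewrite -ltnNge -/(pop k); move: (size L) (pop k) => a b; lia.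
- by move=> B [uB sB] pB; exact: IH.
Qed.

(** The lanes are independent and both have to fail. *)
Lemma prob_segment k z A : (jtime k <= H)%N -> cross_prob k ->
  {subset A <= source k z} -> (2 * pop k <= size A)%N ->
  prob r H (segment (cross k) k z A) (fun L => (size L < 2 * pop k)%N) <= (eps k + q) ^+ 2.
Proof.
move=> TH IH sA szA; rewrite prob_choice // expr2.
have pk : (pop k <= size A)%N by move: szA; move: (pop k) (size A) => a b; lia.
apply: ler_pM; try exact: prob_ge0; apply: prob_lane => //.
- by move=> a /mem_take /sA; exact: near_source.
- by rewrite size_take_min leq_min leqnn.
- by move=> a /mem_drop /sA; exact: near_source_lane.
- by rewrite size_drop; move: szA; move: (pop k) (size A) => a b; lia.
Qed.

Lemma prob_segments k n z A : (jtime k <= H)%N -> cross_prob k -> uniq A ->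
  {subset A <= cube z (2 * side k)} -> (2 * pop k <= size A)%N ->
  prob r H (segments (cross k) k n z A) (fun L => (size L < 2 * pop k)%N)
    <= n%:R * (eps k + q) ^+ 2.
Proof.
move=> TH IH uA sA szA; elim: n => [|n IHn] /=.
  by rewrite mul0r /prob /= ltnNge szA.
have [_ ls _] := stage_segments n TH (stage_cross TH) uA sA.
rewrite -natr1 mulrDl mul1r.
apply: (prob_bind_leaves (g := fun L => (2 * pop k <= size L)%N) r01 d_gt0 _ ls).
- exact: sqr_ge0.
- by apply: le_trans IHn; apply: prob_sub => // L; rewrite -ltnNge.
- move=> B [uB sB] szB; apply: prob_segment => // x /sB.
  have /andP[_ b2] := seg_start_pos k n.
  clear - b2; apply: region_sub; rewrite ?shiftE ?eqxx; try lia.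
  by move=> c ci; rewrite shiftE (negPf ci); lia.
Qed.

Lemma cube_source k z x : cube z (side k) x -> source k (shift i (side k) z) x.
Proof.
clear; rewrite cube_region; apply: region_sub; rewrite ?shiftE ?eqxx; try lia.
by move=> c ci; rewrite shiftE (negPf ci); lia.
Qed.

(** The 8 segments fail with probability at most [8 (eps k + q)^2] in total and the last leap with
    probability at most [eps k]; thanks to the square, the same [q] serves at all levels. *)
Lemma prob_cross k : (jtime k <= H)%N -> cross_prob k.
Proof.
elim: k => [|k IH] TH z A uA sA szA; have [e0 eq] := eps_q 0.
  have n0 : {in A, forall a, near_cube (radius 0) a (shift i (side 0) z)}.
    by move=> a /sA; move/cube_source; exact: near_source.
  apply: (@le_trans _ _ (eps 0)); last by have := sqr_ge0 (eps 0 + q); lra.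
  apply: le_trans (leap_fail TH szA n0); apply: prob_sub => // L.
  by rewrite -/(pop 0); move: (size L) (pop 0) => a b; lia.
have {e0 eq} [e0 eq] := eps_q k.
have TH' : (jtime k <= H)%N by apply: leq_trans TH; exact: jtime_le.
have {}IH := IH TH'.
have popS : pop k.+1 = (2 * pop k)%N by rewrite /pop expnS mulnCA.
rewrite popS in szA *; apply: le_trans eq.
rewrite /= -/(len k.+1) lenS.
have sA' : {subset A <= cube z (2 * side k)} by rewrite -sideS.
have [_ ls _] := stage_segments 8 TH' (stage_cross TH') uA sA'.
apply: (prob_bind_leaves (g := fun L => (2 * pop k <= size L)%N) r01 d_gt0 e0 ls).
  apply: le_trans (prob_segments 8 TH' IH uA sA' szA).
  by apply: prob_sub => // L; rewrite -ltnNge.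
move=> B [uB sB] szB; have pk : (pop k <= size B)%N.
  by move: szB; move: (pop k) (size B) => a b; lia.
apply: le_trans (leap_fail TH' pk _); first by apply: prob_sub => // L; rewrite mulnA.
move=> b /sB hb; apply: near_source; move: hb.
have /andP[_ b2] := seg_start_pos k 8.
clear - b2; apply: region_sub; rewrite ?shiftE ?eqxx; try lia.
by move=> c ci; rewrite shiftE (negPf ci); lia.
Qed.

(** Leaps of decreasing scales, so that the distance left to the target, and with it the probability
    of the final hit, does not depend on the level of the crossing. *)
Fixpoint descend k z A :=
  if k is k'.+1 then bind (leap k z A) (descend k' (shift i (side k) z)) else leap 0 z A.
Fixpoint descent k : nat := if k is k'.+1 then side k + descent k' else 0.
Fixpoint dtime k : nat := if k is k'.+1 then jtime k + dtime k' else jtime 0.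

Lemma stage_descend k z A (jw : pred site) : (jtime k <= H)%N -> uniq A ->
  {subset A <= jw} -> (forall x, jw x -> x ord0 i < z ord0 i) ->
  stage R H A (descend k z A) (region z 0 (descent k + side 0)%N (side k))
    (fun x => jw x || region z 0 (descent k) (side k) x)
    (cube (shift i (descent k) z) (side 0)) (dtime k).
Proof.
clear leap_fail eps_q q_ge0 rho_gt0 r01 d_gt0 ji.
elim: k z A jw => [|k IH] z A jw TH uA sA bA /=.
  apply: stage_leap => //.
  - by move=> x xA; apply/orP; left; exact: sA.
  - by move=> x; rewrite cube_region.
  - move=> x; rewrite !cube_region; apply: region_sub; rewrite ?shiftE ?eqxx; try lia.
    by move=> c ci; rewrite shiftE (negPf ci); lia.
have TH' : (jtime k <= H)%N by apply: leq_trans TH; exact: jtime_le.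
set S := side k.+1; set z' := shift i S z.
have z'i : z' ord0 i = z ord0 i + S%:Z by rewrite shiftE eqxx.
have z'c c : c != i -> z' ord0 c = z ord0 c by move=> ci; rewrite shiftE (negPf ci) addr0.
have S2 : S = (2 * side k)%N by exact: sideS.
have blw x : cube z S x -> x ord0 i < z' ord0 i.
  by move=> /cubeP /(_ i) /andP[_]; rewrite z'i.
have st1 : stage R H A (leap k.+1 z A) (cube z S) jw (cube z S) (jtime k.+1).
  exact: stage_leap.
have st := stage_bind _ _ st1 (fun B uB sB => IH z' B (cube z S) TH' uB sB blw).
have e : shift i (descent k) z' = shift i (S + descent k)%N z.
  by rewrite /z' /shift (mulrnDr _ S) addrA.
rewrite -e; apply: (stage_sub _ _ _ _ (st _ _)) => //.
- move=> x /orP[]; rewrite ?cube_region; apply: region_sub; rewrite ?z'i; try lia.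
  by move=> c ci; rewrite z'c //; lia.
- move=> x /orP[->//|/orP[]]; rewrite ?cube_region => hx; apply/orP; right; move: hx;
    apply: region_sub; rewrite ?z'i; try lia.
  by move=> c ci; rewrite z'c //; lia.
- move=> x /blw h1; apply/regionP => /(_ i); rewrite eqxx addr0 => /andP[h2 _].
  by rewrite ltNge h2 in h1.
- move=> x /bA h1; apply/orP => -[/cubeP /(_ i)|/regionP /(_ i)]; rewrite ?eqxx ?z'i;
    move: (x ord0 i) (z ord0 i) h1 => a b; lia.
Qed.

Lemma prob_descend k z A : (jtime k <= H)%N -> (0 < m)%N ->
  {subset A <= source k z} -> (pop k <= size A)%N ->
  prob r H (descend k z A) (fun L => (size L < 1)%N) <= \sum_(l < k.+1) eps l.
Proof.
move=> TH m0; elim: k z A TH => [|k IH] z A TH sA szA; rewrite big_ord_recr /=.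
  rewrite big_ord0 add0r; apply: le_trans (leap_fail TH szA _).
    by apply: prob_sub => // L; move: (size L) => a; move: m0; clear; lia.
  by move=> a /sA; exact: near_source.
have TH' : (jtime k <= H)%N by apply: leq_trans TH; exact: jtime_le.
rewrite addrC.
apply: (@prob_bind_leaves _ _ _ _ r01 d_gt0 _ _ _ _
  (fun L => uniq L /\ {subset L <= cube z (side k.+1)}) (fun L => (pop k <= size L)%N)) => //.
- by apply: sumr_ge0 => l _; case: (eps_q l).
- apply: leaves_sub (leaves_jump (jtime k.+1) (h k.+1) A (cube_seq_uniq z (side k.+1))).
  by move=> L [uL sL]; split=> // x /sL; rewrite mem_cube_seq.
- apply: le_trans (leap_fail TH szA _); last by move=> a /sA; exact: near_source.
  apply: prob_sub => // L; rewrite -ltnNge -/(pop k.+1).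
  have -> : pop k.+1 = (2 * pop k)%N by rewrite /pop expnS mulnCA.
  by move: (size L) (pop k) => a b; lia.
- move=> B [uB sB] szB; apply: IH => // x /sB hx; move: (hx : cube z (side k.+1) x).
  rewrite cube_region sideS; clear; apply: region_sub; rewrite ?shiftE ?eqxx; try lia.
  by move=> c ci; rewrite shiftE (negPf ci); lia.
Qed.

(** The walk may follow a shortest path, each step of which has probability [1 / (2 d)]. *)
Lemma walkE_hits_ge D x y : (l1z (y - x) <= D%:Z)%R ->
  (2 * d)%:R^-1 ^+ D <= walk_exp (@srw R d) D (hits R y x).
Proof.
clear leap_fail eps_q q_ge0 rho_gt0.
have c0 : 0 <= (2 * d)%:R^-1 :> R by rewrite invr_ge0.
have c1 : (2 * d)%:R^-1 <= 1 :> R.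
  have d1 : 1 <= (2 * d)%:R :> R by rewrite ler1n muln_gt0.
  by rewrite invf_le1 // (lt_le_trans ltr01 d1).
elim: D x => [|D IH] x; have [<-|xy] := eqVneq x y.
- by rewrite walkE_hits_diag.
- move=> h0; exfalso; move/negP: xy; apply; apply/eqP/rowP => c; apply/eqP.
  rewrite eq_sym -subr_eq0 -normr_le0; apply: le_trans h0.
  by rewrite /l1z (bigD1 c) //= !mxE lerDl sumr_ge0.
- by move=> _; rewrite walkE_hits_diag // exprn_ile1.
move=> hl; have [c xc] : exists c, x ord0 c != y ord0 c.
  apply/existsP; rewrite -[X in is_true X]negbK; apply/negP => /existsPn hx.
  by move/negP: xy; apply; apply/eqP/rowP => c; have := hx c; rewrite negbK => /eqP.
(* A step towards [y] in a coordinate that is still wrong. *)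
pose s : 'I_d * bool := (c, x ord0 c < y ord0 c).
have hs : (l1z (y - (x + step_vec s)) <= D%:Z)%R.
  have e : l1z (y - (x + step_vec s)) + 1 = l1z (y - x).
    rewrite /l1z (bigD1 c) //= [in RHS](bigD1 c) //=.
    rewrite (eq_bigr (fun l => `|(y - x) ord0 l|)); last first.
      move=> l lc; rewrite /step_vec /s /=; case: ifP => _; rewrite !mxE (negPf lc) andbF.
        by rewrite addr0.
      by rewrite oppr0 addr0.
    set W := \sum_(_ | _) _; move: W => W.
    rewrite /step_vec /s /=; move: xc; case: ifP; rewrite !mxE !eqxx /=;
      move: (x ord0 c) (y ord0 c) => a b; clear; lia.
  by move: hl; rewrite -e; move: (l1z _) => a; clear; lia.
rewrite walkE_hitsS // exprS (bigD1 s) //=; apply: ler_wpDr.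
  apply: sumr_ge0 => t _; apply: mulr_ge0; first exact: srw_ge0.
  exact: walkE_hits_ge0.
by apply: ler_wpM2l; [exact: c0|exact: IH].
Qed.

Variables (K D : nat) (p1 : R).
Hypothesis leap_one : forall z, near_cube (radius K) 0 z ->
  prob r H (leap K z [:: 0]) (fun L => (size L < pop K)%N) <= 1 - p1.
Hypothesis KH : (jtime K <= H)%N.
Hypothesis DH : (D <= H)%N.
Hypothesis D_side : (d * side 0 <= D)%N.
Hypothesis m_gt0 : (0 < m)%N.

(** The shift by one keeps the origin, whose occupation and walk are revealed first, out of the
    boxes explored later. *)
Definition gate : site := shift i 1 0.
Definition landing : site := shift i (len K + side K) gate.
Definition reach_len := (len K + side K + descent K)%N.
Definition base : site := shift i reach_len gate.
Definition target : site := shift i (reach_len + side 0) gate.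

Definition journey : prog d (seq site) :=
  bind (leap K gate [:: 0]) (fun A => bind (cross K gate A) (descend K landing)).

Definition journey_time := (jtime K + (ctime K + dtime K))%N.

Lemma gate_i : gate ord0 i = 1.
Proof. by rewrite shiftE eqxx mxE add0r. Qed.

Lemma region_disjoint y z a b a' b' l l' x : y ord0 i + b <= z ord0 i + a' ->
  region y a b l x -> ~~ region z a' b' l' x.
Proof.
move=> hyz /regionP /(_ i); rewrite eqxx => /andP[_ h1].
apply/regionP => /(_ i); rewrite eqxx => /andP[h2 _].
by have := lt_le_trans h1 (le_trans hyz h2); rewrite ltxx.
Qed.

Lemma leap_len_ge k : (side k <= len k)%N.
Proof. by case: k => [|k] //=; rewrite sideS; move: (side k) (len k) => a b; clear; lia. Qed.

Lemma stage_journey : stage R H [:: 0] journey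
  (region gate 0 (reach_len + side 0)%N (side K))
  (fun x => (x == 0) || region gate 0 reach_len (side K) x)
  (cube base (side 0)) journey_time.
Proof.
clear leap_fail eps_q q_ge0 leap_one DH D_side.
have st1 : stage R H [:: 0] (leap K gate [:: 0]) (cube gate (side K)) (pred1 0)
    (cube gate (side K)) (jtime K).
  by apply: stage_leap => // x; rewrite inE => /eqP->; rewrite unfold_in /=.
have st2 A (uA : uniq A) (sA : {subset A <= cube gate (side K)}) := stage_cross KH uA sA.
have li : landing ord0 i = gate ord0 i + (len K + side K)%N%:Z by rewrite shiftE eqxx.
have lc c : c != i -> landing ord0 c = gate ord0 c by move=> ci; rewrite shiftE (negPf ci) addr0.
have blw x : cube (shift i (len K) gate) (side K) x -> x ord0 i < landing ord0 i.
  by move=> /cubeP /(_ i) /andP[_]; rewrite li shiftE eqxx PoszD addrA.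
have st3 B (uB : uniq B) (sB : {subset B <= cube (shift i (len K) gate) (side K)}) :=
  stage_descend KH uB sB blw.
have cr x : cube (shift i (len K) gate) (side K) x ->
    region gate (len K) (len K + side K)%N (side K) x.
  rewrite cube_region; apply: region_sub; rewrite ?shiftE ?eqxx; try (clear; lia).
  by move=> c ci; rewrite shiftE (negPf ci); clear; lia.
have st23 A (uA : uniq A) (sA : {subset A <= cube gate (side K)}) :
  stage R H A (bind (cross K gate A) (descend K landing))
   (region gate (side K) (reach_len + side 0)%N (side K))
   (region gate 0 reach_len (side K)) (cube base (side 0)) (ctime K + dtime K).
  have st := stage_bind _ _ (st2 A uA sA) st3.
  have e : shift i (descent K) landing = base.
    by rewrite /base /landing /reach_len /shift (mulrnDr _ (len K + side K)) addrA.
  rewrite -e; apply: (stage_sub _ _ _ _ (st _ _)) => //.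
  - move=> x /orP[]; apply: region_sub; rewrite ?li /reach_len.
    + by clear; lia.
    + by clear; lia.
    + by clear; lia.
    + by have := leap_len_ge K; clear; lia.
    + by clear; lia.
    + by move=> c ci; rewrite lc //; clear; lia.
  - move=> x /orP[|/orP[/cr|]]; apply: region_sub; rewrite ?li /reach_len;
      try (clear; lia).
    by move=> c ci; rewrite lc //; clear; lia.
  - by move=> x; apply: region_disjoint; rewrite li; clear; lia.
  - move=> x hx; rewrite negb_or; apply/andP; split.
      by apply: contraL hx => /cr; apply: contraL; apply: region_disjoint; rewrite lexx.
    by move: hx; apply: region_disjoint; rewrite li; clear; lia.
have st := stage_bind _ _ st1 st23.
apply: (stage_sub _ _ _ _ (st _ _)) => //.
- move=> x /orP[]; rewrite ?cube_region; apply: region_sub => //; rewrite /reach_len; clear; lia.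
- by move=> x; rewrite cube_region; apply: region_disjoint; clear; lia.
- move=> x /eqP->; apply/regionP => /(_ i).
  by rewrite eqxx gate_i mxE => /andP[].
Qed.

Hypothesis eps_sum : q + \sum_(l < K.+1) eps l <= 1 / 2.

(** The first leap, made by the frog at the origin alone, succeeds with probability at least [p1].
    The crossing and the descent then fail with probability at most [q] plus the sum of the
    [eps l]. *)
Lemma prob_journey :
  p1 * (1 / 2) <= prob r H journey (fun L => (0 < size L)%N).
Proof.
have n0 : near_cube (radius K) 0 gate.
  have rK : (0 < radius K)%N by rewrite muln_gt0 rho_gt0 expn_gt0.
  move=> c; rewrite /gate shiftE !mxE; move: (radius K) rK => a; case: ifP => _; clear; lia.
have lA := leaves_jump (jtime K) (h K) [:: 0] (cube_seq_uniq gate (side K)).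
apply: (prob_bind_ge_leaves (g := fun L => (pop K <= size L)%N) r01 d_gt0 _ lA) => //.
  have := leap_one n0.
  rewrite (_ : prob _ _ _ (fun L => (size L < pop K)%N) =
    1 - prob r H (leap K gate [:: 0]) (fun L => (pop K <= size L)%N)); first by lra.
  by rewrite -probC //; apply: eq_val => // L; rewrite ltnNge.
move=> A [uA sA] szA.
have sA' : {subset A <= cube gate (side K)} by move=> x /sA; rewrite mem_cube_seq.
suff hf : prob r H (bind (cross K gate A) (descend K landing)) (fun L => ~~ (0 < size L)%N)
    <= 1 / 2 by move: hf; rewrite probC //; lra.
apply: le_trans eps_sum.
have [_ ls _] := stage_cross KH uA sA'.
have s0 : 0 <= \sum_(l < K.+1) eps l by apply: sumr_ge0 => l _; case: (eps_q l).
apply: (prob_bind_leaves (g := fun L => (2 * pop K <= size L)%N) r01 d_gt0 s0 ls).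
  apply: le_trans (prob_cross KH uA sA' szA).
  by apply: prob_sub => // L; rewrite -ltnNge.
move=> B [uB sB] szB; apply: (@le_trans _ _
   (prob r H (descend K landing B) (fun L => (size L < 1)%N))).
  by apply: prob_sub => // L; rewrite -leqNgt leqn0 => /eqP->.
apply: prob_descend => //; last first.
  by move: szB; move: (pop K) (size B) => a b; clear; lia.
move=> x /sB hx; have := cube_source (hx : cube _ _ x).
by rewrite /landing /shift (mulrnDr _ (len K)) addrA.
Qed.

Definition knock C : prog d bool :=
  if C is c :: _ then AskW c (fun t => Ret d (target \in traj c (take D t)))
  else Ret d false.

Definition launch : prog d bool :=
  AskO 0 (fun b => if b then bind journey knock else Ret d false).

Lemma target_base : target = shift i (side 0) base.
Proof. by rewrite /target /base /shift (mulrnDr _ reach_len) addrA. Qed.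

Lemma within_launch : exists jo jw, within launch jo jw.
Proof.
have [wj lj _] := stage_journey.
have wk C : uniq C /\ {subset C <= cube base (side 0)} ->
    within (knock C) pred0 (cube base (side 0)).
  by case: C => [|c C] //= [_ sC]; split=> //; apply: sC; rewrite mem_head.
have w := within_bind_leaves _ _ lj wj wk.
exists (fun x => (x == 0) || region gate 0 (reach_len + side 0)%N (side K) x).
exists (fun x => ((x == 0) || region gate 0 reach_len (side K) x) || cube base (side 0) x).
split; first by rewrite eqxx.
case=> //; apply: within_sub (w _ _) => // x.
- rewrite orbF => hx; rewrite hx orbT /=; apply: contraL hx => /eqP ->.
  by apply/regionP => /(_ i); rewrite eqxx gate_i mxE => /andP[].
- rewrite cube_region => /orP[/eqP -> | ].
    apply/regionP => /(_ i); rewrite eqxx shiftE eqxx gate_i mxE => /andP[].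
    by clear; lia.
  by apply: region_disjoint; rewrite [base ord0 i]shiftE eqxx; clear; lia.
Qed.

Lemma prob_launch :
  r * (p1 * (1 / 2) * (2 * d)%:R^-1 ^+ D) <= prob r H launch id.
Proof.
have [_ lj _] := stage_journey.
have -> : prob r H launch id = r * prob r H (bind journey knock) id.
  by rewrite /prob /= mulr0 addr0.
apply: ler_wpM2l; first by case/andP: r01.
apply: (prob_bind_ge_leaves (g := fun L => (0 < size L)%N) r01 d_gt0 _ lj).
- by rewrite exprn_ge0 // invr_ge0.
- exact: prob_journey.
case=> [|c C] // [_ sC] _; rewrite /prob /=.
rewrite (walk_exp_take (srw_sum1 R d_gt0) (hits R target c) DH).
apply: walkE_hits_ge; apply: le_trans (_ : (d * side 0)%N%:Z <= _); last by rewrite lez_nat.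
rewrite /l1z; apply: (@le_trans _ _ (\sum_(l < d) (side 0)%:Z)); last first.
  by rewrite sumr_const card_ord -mulr_natl PoszM natz.
have /cubeP hc : cube base (side 0) c by apply: sC; rewrite mem_head.
apply: ler_sum => l _; rewrite [(target - c) _ _]mxE [(- c) _ _]mxE target_base shiftE; have := hc l.
by case: ifP => _; move: (c ord0 l) (base ord0 l) => a b; clear; lia.
Qed.

Lemma holds_launch (Omega : Type) (om : site -> Omega -> bool) S w :
  holds H om S launch
    (fun b => b -> om 0 w /\ (fpt R om S 0 target w <= (journey_time + D)%N%:R%:E)%E) w.
Proof.
set Q : bool -> Prop := fun b => _.
change (holds H om S (if om 0 w then bind journey knock else Ret d false) Q w).
case o0: (om 0 w) => //; apply: holds_bind; rewrite /Q o0.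
have [_ _ hj] := stage_journey.
have r0 : {in [:: 0], forall a, reached R om S w a 0}.
  by move=> a; rewrite inE => /eqP->; exact: reached0.
apply: holds_sub (hj _ _ _ _ _ r0) => -[|c C] //= rC t st ft ht; split=> //.
have /mem_trajP[k kD yk] := ht.
have kD' : (k <= D)%N by apply: leq_trans kD _; rewrite size_take_min geq_minl.
have [] := @reached_cost R d Omega om S w c journey_time k target.
- by have := rC c (mem_head _ _); rewrite add0n.
- rewrite ft ?st; first by rewrite -yk take_takel.
  exact: leq_trans DH.
move=> p lp cp; apply: le_trans (_ : ((journey_time + k)%:R%:E <= _)%E); last first.
  by rewrite lee_fin ler_nat leq_add2l.
by apply: le_trans cp; apply: ereal_inf_lbound; exists p.
Qed.

End Crossing.

(** * Choice of the scale and conclusion *)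

Section Scales.
Variables (R : realType) (d : nat).
Local Notation site := 'rV[int]_d.
Hypothesis d_ge2 : (2 <= d)%N.

Let d_gt0 : (0 < d)%N. Proof. exact: leq_trans d_ge2. Qed.

(** The order of growth of the Green function up to time [n]. *)
Definition log_factor (n : nat) : R := if d == 2 then 1 + ln (1 + n%:R) else 1.

Lemma log_factor_quadruple n : (0 < n)%N -> log_factor (4 * n) <= 2 * log_factor n.
Proof.
move=> n0; rewrite /log_factor; case: ifP => _; last by lra.
have n1 : 1 <= n%:R :> R by rewrite ler1n.
suff : ln (1 + (4 * n)%:R) <= 1 + 2 * ln (1 + n%:R) :> R by lra.
have p : 0 < 1 + n%:R :> R by lra.
have -> : 1 + 2 * ln (1 + n%:R) = ln (expR 1 * (1 + n%:R) ^+ 2) :> R.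
  by rewrite lnM ?posrE ?expR_gt0 ?exprn_gt0 // expRK lnXn // mulr_natl.
have q : 0 < 1 + (4 * n)%:R :> R by rewrite natrM; lra.
rewrite ler_ln ?posrE ?mulr_gt0 ?expR_gt0 ?exprn_gt0 //.
have e2 : 2 <= expR 1 :> R by have := expR_ge1Dx (1 : R); lra.
have s0 : 0 <= (1 + n%:R) ^+ 2 :> R by exact: sqr_ge0.
apply: le_trans (ler_wpM2r s0 e2); rewrite natrM; nra.
Qed.

Lemma green_bound : exists2 C : R, 0 < C & forall n, green R d n <= C * log_factor n.
Proof.
have ln2 : 0 < ln 2 :> R by rewrite ln_gt0 // ltr1n.
have [d2|d2] := eqVneq d 2.
  exists (ln 2)^-1; first by rewrite invr_gt0.
  by move=> n; rewrite /log_factor d2 eqxx; exact: green_two.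
have d3 : (3 <= d)%N by rewrite ltn_neqAle eq_sym d2.
exists (green_const3 R).
  have i10 : 0 < isqrt 10 :> R by rewrite invr_gt0 sqrtr_gt0.
  by rewrite /green_const3 mulr_gt0 // invr_gt0 subr_gt0 isqrt11_lt.
by move=> n; rewrite /log_factor (negPf d2) mulr1; exact: green_three.
Qed.

Lemma jtimeS rho k : jtime rho k.+1 = (4 * jtime rho k)%N.
Proof. by rewrite /jtime /radius [(2 ^ k.+1)%N]expnS mulnCA expnMn. Qed.

Lemma jtime_gt0 rho k : (0 < rho)%N -> (0 < jtime rho k)%N.
Proof. by move=> r0; rewrite !expn_gt0 muln_gt0 r0 expn_gt0. Qed.

Lemma log_factor_jtime rho k : (0 < rho)%N ->
  log_factor (jtime rho k) <= 2 ^+ k * log_factor (jtime rho 0).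
Proof.
move=> r0; elim: k => [|k IH]; first by rewrite expr0 mul1r.
rewrite jtimeS; apply: le_trans (log_factor_quadruple (jtime_gt0 k r0)) _.
by rewrite exprS -mulrA; apply: ler_wpM2l.
Qed.

Lemma jtimeE rho k : (jtime rho k)%:R = 4 ^+ k * (rho ^ 2)%:R :> R.
Proof.
elim: k => [|k IH]; first by rewrite expr0 mul1r /jtime /radius expn0 muln1.
by rewrite jtimeS natrM IH exprS mulrA.
Qed.

Lemma inv_expR_le (x : R) : 0 < x -> expR (- x) <= x^-1.
Proof.
move=> x0; rewrite expRN lef_pV2 ?posrE ?expR_gt0 //.
by apply: le_trans (expR_ge1Dx x); lra.
Qed.

Lemma two_pow_le_expR n : 2 ^+ n <= expR n%:R :> R.
Proof.
rewrite -[n%:R]mulr1 expRM_natl; apply: lerXn2r; rewrite ?nnegrE ?expR_ge0 //.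
by have := expR_ge1Dx (1 : R); lra.
Qed.

Lemma one_sub_pow_le (p : R) n : 0 <= p <= 1 -> (1 - p) ^+ n <= expR (- (n%:R * p)).
Proof.
move=> /andP[p0 p1]; rewrite -mulrN expRM_natl; apply: lerXn2r; rewrite ?nnegrE ?expR_ge0 //.
  by lra.
exact: expR_ge1Dx.
Qed.

Definition hit_prob : R := cube_prob R d / 48.

Lemma hit_prob_gt0 : 0 < hit_prob.
Proof. by rewrite divr_gt0 ?cube_prob_gt0. Qed.

Lemma hit_prob_le1 : hit_prob <= 1.
Proof.
have : cube_prob R d <= 3 / 4.
  rewrite /cube_prob -[leRHS]mulr1; apply: ler_wpM2l; first by lra.
  by rewrite -[leRHS]expR0 ler_expR oppr_le0; apply: mulr_ge0; [exact: ler0n|exact: sqr_ge0].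
by rewrite /hit_prob; lra.
Qed.

(* [r * visit_bound] is the mean number of frogs met by a successful walk. *)
Lemma rate_growth (Y : R) : 0 < Y -> exists2 W : R, 0 < W &
  forall (r : R) rho, 0 <= r -> (20 * d <= rho)%N ->
    W * log_factor (rho ^ 2) <= r * (rho ^ 2)%:R ->
    forall k, 2 ^+ k * Y <= r * visit_bound R d (radius rho k).
Proof.
move=> Y0; have [C C0 gC] := green_bound.
have c0 := cube_prob_gt0 R d; set c := cube_prob R d in c0 *.
exists (4 * Y * C / c); first by apply: divr_gt0 => //; rewrite !mulr_gt0 // ltr0n.
move=> r rho r0 drho hW k.
have rho0 : (0 < rho)%N by apply: leq_trans drho; rewrite muln_gt0 d_gt0.
rewrite /visit_bound -/c -/(jtime rho k).
have g0 := green_gt0 R d_gt0 (jtime rho k).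
rewrite mulrA ler_pdivlMr; last by rewrite mulr_gt0.
have hg : green R d (jtime rho k) <= C * (2 ^+ k * log_factor (rho ^ 2)).
  apply: le_trans (gC _) _; apply: ler_wpM2l; first exact: ltW.
  by have := log_factor_jtime k rho0; rewrite {2}/jtime /radius expn0 muln1.
have p0 : 0 <= 2 ^+ k * Y * 4 by rewrite !mulr_ge0 ?exprn_ge0 // ltW.
rewrite [leLHS]mulrA; apply: le_trans (ler_wpM2l p0 hg) _.
have -> : 2 ^+ k * Y * 4 * (C * (2 ^+ k * log_factor (rho ^ 2))) =
   (4 ^+ k * c) * (4 * Y * C / c * log_factor (rho ^ 2)).
  have -> : 4 ^+ k = 2 ^+ k * 2 ^+ k :> R by rewrite -exprMn; congr (_ ^+ k); ring.
  by field; rewrite gt_eqF.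
rewrite jtimeE; have -> : r * (c * (4 ^+ k * (rho ^ 2)%:R)) = (4 ^+ k * c) * (r * (rho ^ 2)%:R).
  by ring.
by apply: ler_wpM2l => //; rewrite mulr_ge0 ?exprn_ge0 // ltW.
Qed.

Lemma leap_bound (r : R) H rho k (z : site) (A : seq site) n : 0 <= r <= 1 -> (20 * d <= rho)%N ->
  (jtime rho k <= H)%N -> {in A, forall a, near_cube (radius rho k) a z} ->
  prob r H (leap rho (fun k => visit_bound R d (radius rho k)) k z A)
    (fun L => (size L < n)%N)
  <= (1 - hit_prob) ^+ size A + 2 ^+ n * expR (- (r * visit_bound R d (radius rho k) / 2)).
Proof.
move=> r01 drho TH nA; apply: prob_jump_lt => //.
  by rewrite (ltW hit_prob_gt0) hit_prob_le1.
move=> a aA; apply: le_trans (@many_visits_in_cube R d d_gt0 (radius rho k) a z _ (nA a aA)) _.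
  by apply: leq_trans drho _; rewrite leq_pmulr // expn_gt0.
by apply: le_walk_exp => [s|w _]; [exact: srw_ge0 | rewrite nvisited_size].
Qed.

Lemma scan_tail (r Y Z : R) rho k n : 0 < Z -> n%:R <= 2 ^+ k * (Y / 2 - Z) ->
  2 ^+ k * Y <= r * visit_bound R d (radius rho k) ->
  2 ^+ n * expR (- (r * visit_bound R d (radius rho k) / 2)) <= (2 ^+ k * Z)^-1.
Proof.
move=> Z0 hn hY.
apply: le_trans (ler_wpM2r (expR_ge0 _) (two_pow_le_expR n)) _.
have z0 : 0 < 2 ^+ k * Z by rewrite mulr_gt0 ?exprn_gt0.
by rewrite -expRD; apply: le_trans (inv_expR_le z0); rewrite ler_expR; lra.
Qed.

(** The lower bound contains no [K]: for fixed [r] and [rho] it holds uniformly over the levels. *)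
Lemma launch_constants : exists m : nat, exists2 W : R, (0 < m)%N /\ 0 < W &
  forall (r : R) rho, 0 <= r <= 1 -> (20 * d <= rho)%N ->
    W * log_factor (rho ^ 2) <= r * (rho ^ 2)%:R ->
    forall (i j : 'I_d) K D H, j != i -> (jtime rho K <= H)%N -> (D <= H)%N ->
      (d * side rho 0 <= D)%N ->
      r * (hit_prob / 4 * (2 * d)%:R^-1 ^+ D) <=
      prob r H (launch i j rho m (fun k => visit_bound R d (radius rho k)) K D) id.
Proof.
have p0 := hit_prob_gt0; have p1 := hit_prob_le1; set p := hit_prob in p0 p1 *.
(* Leaps of level [k] will fail with probability at most [e / 2^k]. With [q = 1 / 20] and
   [e <= 1 / 100], [8 (e + q)^2 + e] is below [q]. *)
have [e e0 e1] : exists2 e : R, 0 < e & e <= 1 / 100 by exists (1 / 100); lra.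
have [M M0 eM] : exists2 M : R, 0 < M & e = M^-1 + M^-1.
  by exists (2 / e); [rewrite divr_gt0|field; rewrite gt_eqF].
(* With [m * 2^k] frogs, all walks fail with probability at most [expR (- 2^k M) <= 1 / (2^k M)],
   one half of [e / 2^k]. *)
have [m m0 mp] : exists2 m : nat, (0 < m)%N & M <= m%:R * p.
  exists (Num.trunc (M / p)).+1 => //.
  by rewrite -ler_pdivrMr // ltW // truncnS_gt.
have q0 : 0 < 2 / p by rewrite divr_gt0.
(* [1 / (2^k Z)] will bound the probability of meeting too few frogs. [M <= Z] makes it at most half
   of [e / 2^k], and [1 / Z <= p / 2] leaves the single first frog a success probability of at least
   [p / 2]. *)
have [Z ZM Zp] : exists2 Z : R, M <= Z & Z^-1 <= p / 2.
  exists (M + 2 / p); first by lra.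
  rewrite -[p / 2]invrK lef_pV2 ?posrE; [|by lra|by rewrite invr_gt0; lra].
  by rewrite invf_div; lra.
have Z0 : 0 < Z by exact: lt_le_trans ZM.
have m0R : 0 < m%:R :> R by rewrite ltr0n.
(* This rate makes room for the [4 * m * 2^k] frogs requested by a leap. *)
have [Y Y0 YE] : exists2 Y : R, 0 < Y & Y / 2 - Z = 4 * m%:R.
  by exists (2 * (4 * m%:R + Z)); [lra|field].
have [W W0 hW] := rate_growth Y0.
exists m, W => // r rho r01 drho hr i j K D H ji KH DH Dd.
have rho0 : (0 < rho)%N by apply: leq_trans drho; rewrite muln_gt0 d_gt0.
have hY := hW r rho (proj1 (andP r01)) drho hr.
have half0 : 0 <= 2^-1 :> R by rewrite invr_ge0.
have half1 : 2^-1 <= 1 :> R by lra.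
pose eps k : R := e * 2^-1 ^+ k.
have eps0 k : 0 <= eps k by apply: mulr_ge0; [exact: ltW|exact: exprn_ge0].
have eps1 k : eps k <= e.
  by rewrite /eps -[leRHS]mulr1; apply: ler_wpM2l; [exact: ltW|exact: exprn_ile1].
have two k : 0 < 2 ^+ k :> R by rewrite exprn_gt0.
have e4 (u : R) : r * (p / 4 * u) = r * (p / 2 * (1 / 2) * u) by field.
have fail k (z : site) (A : seq site) : (jtime rho k <= H)%N -> (m * 2 ^ k <= size A)%N ->
  {in A, forall a, near_cube (radius rho k) a z} ->
  prob r H (leap rho (fun k => visit_bound R d (radius rho k)) k z A)
    (fun L => (size L < 4 * (m * 2 ^ k))%N) <= eps k.
  move=> TH szA nA; apply: le_trans (leap_bound _ r01 drho TH nA) _.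
  have -> : eps k = (2 ^+ k * M)^-1 + (2 ^+ k * M)^-1.
    by rewrite /eps eM exprVn; field; rewrite !gt_eqF.
  have kM : 0 < 2 ^+ k * M by rewrite mulr_gt0.
  apply: lerD.
    apply: le_trans (one_sub_pow_le _ _) _; first by rewrite (ltW p0) p1.
    have h1 : 2 ^+ k * M <= (size A)%:R * p.
      apply: le_trans (_ : (m * 2 ^ k)%:R * p <= _); last first.
        by apply: ler_wpM2r; [exact: ltW|rewrite ler_nat].
      rewrite natrM natrX [m%:R * _]mulrC -mulrA; apply: ler_wpM2l => //; exact: ltW.
    have h2 := lt_le_trans kM h1.
    by apply: le_trans (inv_expR_le h2) _; rewrite lef_pV2 ?posrE.
  apply: le_trans (@scan_tail r Y Z rho k _ Z0 _ (hY k)) _.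
    by rewrite YE !natrM natrX [m%:R * _]mulrC mulrCA.
  rewrite lef_pV2 ?posrE ?mulr_gt0 //; apply: ler_wpM2l => //; exact: ltW.
have epsq k : 0 <= eps k /\ 8 * (eps k + 1 / 20) ^+ 2 + eps k <= 1 / 20.
  by split; [exact: eps0|have := eps0 k; have := eps1 k; nra].
have q_ge0 : 0 <= 1 / 20 :> R by lra.
have one (z : site) : near_cube (radius rho K) 0 z ->
  prob r H (leap rho (fun k => visit_bound R d (radius rho k)) K z [:: 0])
    (fun L => (size L < pop m K)%N) <= 1 - p / 2.
  move=> nz; have nz' : {in [:: 0], forall a : site, near_cube (radius rho K) a z}.
    by move=> a; rewrite inE => /eqP->.
  apply: le_trans (leap_bound _ r01 drho KH nz') _; rewrite expr1.
  have : 2 ^+ pop m K * expR (- (r * visit_bound R d (radius rho K) / 2)) <= Z^-1.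
    apply: le_trans (@scan_tail r Y Z rho K _ Z0 _ (hY K)) _.
      rewrite YE natrM natrX mulrC; apply: ler_wpM2l; [exact: ltW|lra].
    rewrite lef_pV2 ?posrE ?mulr_gt0 // -[leLHS]mul1r; apply: ler_wpM2r; first exact: ltW.
    by rewrite exprn_ege1 // ler1n.
  by rewrite -/p; lra.
have sum_eps : 1 / 20 + \sum_(l < K.+1) eps l <= 1 / 2.
  have : \sum_(l < K.+1) eps l <= e * 2.
    rewrite /eps -mulr_sumr; apply: ler_wpM2l; first exact: ltW.
    have h n : \sum_(l < n) 2^-1 ^+ l = 2 - 2 * 2^-1 ^+ n :> R.
      elim: n => [|n IH]; first by rewrite big_ord0 expr0; ring.
      by rewrite big_ord_recr /= IH exprS; field.
    by rewrite h gerBl; apply: mulr_ge0 => //; exact: exprn_ge0.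
  lra.
rewrite e4.
exact: (prob_launch r01 d_gt0 ji rho0 fail epsq q_ge0 one KH DH Dd m0 sum_eps).
Qed.

End Scales.

(** * Choice of [rho] of order [delta d r] *)

Section ScaleChoice.
Variables (R : realType) (d : nat).

Lemma scale_exists (W : R) : 0 < W -> exists A : R, 0 < A /\ exists r0 : R, 0 < r0 /\
  forall r, 0 < r -> r <= 1 -> r <= r0 -> exists rho : nat,
  [/\ (20 * d <= rho)%N, W * log_factor R d (rho ^ 2) <= r * (rho ^ 2)%:R
    & rho%:R <= A * delta d r].
Proof.
(* [B] ensures both [B ^+ 2 >= 4 W] and [rho >= 20 d]; the 4 is the one in the bound [4 * l] for the
   logarithmic factor. *)
move=> W0; pose B : R := 4 * W + 20 * d%:R + 1.
have dR : 0 <= d%:R :> R by exact: ler0n.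
have B1 : 1 <= B by rewrite /B; lra.
have BW : 4 * W <= B ^+ 2 by rewrite /B; nra.
have Bd : 20 * d%:R <= B by rewrite /B; lra.
have B0 : 0 < B by lra.
have pick D : 1 <= D -> exists rho : nat,
    [/\ (20 * d <= rho)%N, B * D <= rho%:R & rho%:R <= 2 * B * D].
  (* Rounding up costs at most a factor 2, because [B * D >= 1]. *)
  move=> D1; exists (Num.trunc (B * D)).+1.
  have BD : B <= B * D by rewrite -{1}[B]mulr1; apply: ler_wpM2l; [exact: ltW|].
  have lo : B * D <= (Num.trunc (B * D)).+1%:R by rewrite ltW // truncnS_gt.
  split=> //; first by rewrite -(ler_nat R) natrM; lra.
  rewrite -natr1; have : (Num.trunc (B * D))%:R <= B * D by rewrite truncn_le; lra.
  by lra.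
exists (2 * B); split; first by lra.
have [d2|d2] := eqVneq d 2; last first.
  exists 1; split=> // r r0 r1 _.
  have sr : 0 < Num.sqrt r by rewrite sqrtr_gt0.
  have D1 : 1 <= delta d r.
    rewrite /delta (negPf d2) -[1]invr1 lef_pV2 ?posrE // -sqrtr1.
    exact: ler_wsqrtr.
  have [rho [h1 h2 h3]] := pick _ D1; exists rho; split=> //.
  rewrite /log_factor (negPf d2) mulr1.
  have {}h2 : B <= Num.sqrt r * rho%:R.
    by move: h2; rewrite /delta (negPf d2) ler_pdivrMr // mulrC.
  have : B ^+ 2 <= (Num.sqrt r * rho%:R) ^+ 2 by rewrite lerXn2r ?nnegrE; lra.
  by rewrite exprMn (sqr_sqrtr (ltW r0)) natrX; lra.
have e0 : 0 < expR (- 1) :> R by exact: expR_gt0.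
have B8 : 0 < (8 * B ^+ 2)^-1 by rewrite invr_gt0 mulr_gt0 // exprn_gt0.
(* The first threshold gives [|ln r| >= 1], the second [8 B^2 <= 1 / r]. *)
exists (Num.min (expR (- 1)) (8 * B ^+ 2)^-1); split.
  by rewrite lt_min e0.
move=> r r0 r1; rewrite le_min => /andP[re rB].
pose l := `|ln r|.
have ln1 : ln r <= - 1 by rewrite -[leRHS]expRK ler_ln ?posrE.
have lE : l = - ln r by rewrite /l ler0_norm //; lra.
have l1 : 1 <= l by rewrite lE; lra.
have ri : 0 < r^-1 by rewrite invr_gt0.
have lr : l <= r^-1.
  rewrite lE -lnV ?posrE //; apply: le_trans (_ : r^-1 - 1 <= _); last by lra.
  have := @le_ln1Dx R (r^-1 - 1); have -> : 1 + (r^-1 - 1) = r^-1 by ring.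
  by apply; lra.
have D1 : 1 <= delta d r.
  rewrite /delta d2 eqxx -/l -sqrtr1; apply: ler_wsqrtr.
  by rewrite ler_pdivlMr // mul1r; lra.
have [rho [h1 h2 h3]] := pick _ D1; exists rho; split=> //.
have D2 : delta d r ^+ 2 = l / r.
  by rewrite /delta d2 eqxx -/l sqr_sqrtr //; apply: divr_ge0; lra.
have lo : B ^+ 2 * (l / r) <= (rho ^ 2)%:R.
  by rewrite -D2 -exprMn natrX lerXn2r ?nnegrE //; nra.
have hi : (rho ^ 2)%:R <= 4 * B ^+ 2 * (l / r).
  have -> : 4 * B ^+ 2 * (l / r) = (2 * B * delta d r) ^+ 2 by rewrite -D2; ring.
  by rewrite natrX lerXn2r ?nnegrE //; nra.
have lr1 : 1 <= l / r by rewrite ler_pdivlMr // mul1r; lra.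
have b8 : 8 * B ^+ 2 <= r^-1.
  by rewrite -[leLHS]invrK lef_pV2 ?posrE.
(* A polynomial bound in [1 / r] makes the logarithmic factor of order [|ln r|], which matches the
   factor [|ln r|] in [delta d r ^+ 2]. *)
have cube3 : 1 + (rho ^ 2)%:R <= r^-1 ^+ 3.
  apply: (@le_trans _ _ (8 * B ^+ 2 * (l / r))); first by nra.
  have -> : r^-1 ^+ 3 = r^-1 * (r^-1 / r) by rewrite !exprS expr0; ring.
  apply: ler_pM => //; [by rewrite mulr_ge0 ?sqr_ge0|by lra|].
  by apply: ler_wpM2r => //; exact: ltW.
have lg : log_factor R d (rho ^ 2) <= 4 * l.
  rewrite /log_factor d2 eqxx; suff : ln (1 + (rho ^ 2)%:R) <= 3 * l by lra.
  apply: (@le_trans _ _ (ln (r^-1 ^+ 3))).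
    by rewrite ler_ln ?posrE ?exprn_gt0 // ltr_pwDl.
  by rewrite lnXn // lnV ?posrE // lE mulr_natl.
apply: le_trans (ler_wpM2l (ltW W0) lg) _.
apply: (@le_trans _ _ (r * (B ^+ 2 * (l / r)))); last by apply: ler_wpM2l; [exact: ltW|].
have -> : r * (B ^+ 2 * (l / r)) = B ^+ 2 * l by field; rewrite gt_eqF.
by rewrite mulrCA mulrA; apply: ler_wpM2r; lra.
Qed.

End ScaleChoice.

(** * Lengths and durations of the crossings *)

Section Lengths.
Variable rho : nat.

Lemma jtime_pow l : jtime rho l = (4 ^ l * rho ^ 2)%N.
Proof. by rewrite /jtime /radius expnMn -expnM mulnC [(l * 2)%N]mulnC expnM. Qed.

(** Closed form of the recursion [c' = 8 c + 9 * 4^k rho^2]: the leaps between lanes only affect the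
    constant in front of [8^k rho^2]. *)
Lemma ctimeE k : (4 * ctime rho k + 9 * (4 ^ k * rho ^ 2) = 13 * (8 ^ k * rho ^ 2))%N.
Proof.
elim: k => [|k IH]; first by rewrite /= jtime_pow !expn0; move: (rho ^ 2)%N => s; lia.
rewrite /= jtime_pow [(4 ^ k.+1)%N]expnS [(8 ^ k.+1)%N]expnS -!mulnA; move: IH.
by move: (ctime rho k) (4 ^ k * rho ^ 2)%N (8 ^ k * rho ^ 2)%N => a b c; lia.
Qed.

Lemma dtime_le k : (dtime rho k <= 2 * (4 ^ k * rho ^ 2))%N.
Proof.
elim: k => [|k IH] /=; rewrite jtime_pow; first by rewrite expn0; move: (rho ^ 2)%N => s; lia.
rewrite [(4 ^ k.+1)%N]expnS -!mulnA; move: IH.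
by move: (dtime rho k) (4 ^ k * rho ^ 2)%N => a b; lia.
Qed.

Lemma len_ge k : (4 * rho * 8 ^ k <= len rho k)%N.
Proof.
elim: k => [|k IH]; first by rewrite /= /side /radius !expn0; lia.
rewrite expnS /=; move: IH; move: (len rho k) (side rho k) (8 ^ k)%N => a b c; lia.
Qed.

(** The total duration is at most [8 * 8^K rho^2], and the length at least [4 rho 8^K]. *)
Lemma journey_time_le d K : (20 * d <= rho)%N ->
  (journey_time rho K + d * side rho 0 <= 2 * rho * len rho K)%N.
Proof.
move=> drho; have h1 := len_ge K; have h2 := dtime_le K; have h3 := ctimeE K.
have h4 : (4 ^ K <= 8 ^ K)%N by elim: (K) => // n IH; rewrite !expnS leq_mul.
have h5 : (0 < 8 ^ K)%N by rewrite expn_gt0.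
have h6 : (2 * rho * (4 * rho * 8 ^ K) <= 2 * rho * len rho K)%N by rewrite leq_mul2l h1 orbT.
apply: leq_trans h6; rewrite /journey_time jtime_pow /side /radius expn0 muln1.
have h7 : (d * (4 * rho) <= rho ^ 2)%N by rewrite expnS expn1; nia.
have h8 : (rho ^ 2 <= 8 ^ K * rho ^ 2)%N by rewrite leq_pmull.
have h9 : (4 ^ K * rho ^ 2 <= 8 ^ K * rho ^ 2)%N by rewrite leq_mul2r h4 orbT.
have -> : (2 * rho * (4 * rho * 8 ^ K) = 8 * (8 ^ K * rho ^ 2))%N by rewrite expnS expn1; lia.
move: h2 h3 h7 h8 h9.
move: (ctime rho K) (dtime rho K) (8 ^ K * rho ^ 2)%N (4 ^ K * rho ^ 2)%N (d * (4 * rho))%N (rho ^ 2)%N.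
by move=> a b c e f g; lia.
Qed.

End Lengths.

(** * Passage to the limit along an axis *)

Section Limit.
Local Open Scope classical_set_scope.
Context {R : realType} {dT : measure_display} {Omega : measurableType dT}.
Variable P : probability Omega R.

(** Fatou's lemma for events, by continuity from above along the decreasing unions. *)
Lemma lim_sup_set_ge (E : (set Omega)^nat) (c : R) :
  (forall k, measurable (E k)) -> (forall k, (c%:E <= P (E k))%E) ->
  (c%:E <= P (lim_sup_set E))%E.
Proof.
move=> mE cE.
have mU n : measurable (\bigcup_(k in [set k | (n <= k)%N]) E k).
  by apply: bigcup_measurable => k _.
have cv : (P (\bigcup_(k in [set k | (n <= k)%N]) E k) @[n --> \oo] --> P (lim_sup_set E)).
  apply: lim_sup_set_cvg => //; apply: le_lt_trans (probability_le1 P (mU 0%N)) _.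
  by rewrite ltry.
apply: cvge_to_ge cv _; near=> n.
apply: le_trans (cE n) _; apply: le_measure; rewrite ?inE //.
by move=> w Ew; exists n => /=.
Unshelve. all: by end_near.
Qed.

(** The limsup event has positive probability and so cannot be contained in the exceptional null
    set. *)
Lemma ae_frequently (E : (set Omega)^nat) (c : R) (Q : Omega -> Prop) : 0 < c ->
  (forall k, measurable (E k)) -> (forall k, (c%:E <= P (E k))%E) ->
  {ae P, forall w, Q w} -> exists w, Q w /\ forall n, exists2 k, (n <= k)%N & E k w.
Proof.
move=> c0 mE cE [N [mN N0 QN]]; apply: contrapT => hno.
have sub : lim_sup_set E `<=` N.
  move=> w hw; apply: QN => /= Qw; apply: hno; exists w; split=> // n.
  by have [k /= nk Ek] := hw n I; exists k.
have mL : measurable (lim_sup_set E).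
  apply: bigcap_measurableType => n _.
  by apply: bigcup_measurable => k _.
have : (P (lim_sup_set E) <= P N)%E by apply: le_measure; rewrite ?inE.
rewrite N0 => h; have := le_trans (lim_sup_set_ge mE cE) h.
by rewrite lee_fin leNgt c0.
Qed.

Lemma cvg_le_frequently (u : nat -> \bar R) (l b : R) (n : nat -> nat) :
  u k @[k --> \oo] --> l%:E -> (forall k, (k <= n k)%N) ->
  (forall k0, exists2 k, (k0 <= k)%N & (u (n k) <= b%:E)%E) -> l <= b.
Proof.
move=> cv nk hb; rewrite leNgt; apply/negP => bl.
have [k0 _ hk0] : \forall k \near \oo, (b%:E < u k)%E.
  have nl : nbhs l%:E (fun y : \bar R => (b%:E < y)%E).
    by apply: open_ereal_gt'; rewrite lte_fin.
  exact: (cv _ nl).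
have [k kk hk] := hb k0.
by have := hk0 (n k) (leq_trans kk (nk k)); rewrite /= ltNge hk.
Qed.

End Limit.

Lemma targetE (d : nat) (i : 'I_d) rho K :
  target i rho K = delta_mx ord0 i *+ (reach_len rho K + side rho 0).+1.
Proof. by rewrite /target /shift /gate /shift add0r -mulrnDr add1n. Qed.

Section AxisBound.
Local Open Scope classical_set_scope.
Variables (R : realType) (d : nat) (r : R) (dT : measure_display).
Variables (Omega : measurableType dT) (P : probability Omega R).
Variables (om : 'rV[int]_d -> Omega -> bool)
  (S : 'rV[int]_d -> nat -> Omega -> 'rV[int]_d).
Hypothesis law : frog_law P r om S.
Variable mu : 'rV[R]_d -> R.
Hypothesis tc : time_constant P om S mu.
Hypothesis d_gt0 : (0 < d)%N.

(** As [c] does not depend on [K], at some sample point the limit exists and infinitely many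
    launches succeed; along these, the passage time is at most [2 rho] times the distance. *)
Lemma axis_bound (i j : 'I_d) (rho m : nat) (h : nat -> R) (c : R) :
  j != i -> (20 * d <= rho)%N -> 0 < c ->
  (forall K H, (jtime rho K <= H)%N -> (d * side rho 0 <= H)%N ->
     c <= prob r H (launch i j rho m h K (d * side rho 0)) id) ->
  mu (delta_mx ord0 i) <= 2 * rho%:R.
Proof.
move=> ji drho c0 hc; have [_ ae] := tc.
pose D := (d * side rho 0)%N; pose H K := maxn (jtime rho K) D.
pose E K : set Omega := [set w | sem (H K) om S (launch i j rho m h K D) id w].
have mE K : measurable (E K) by exact: (measurable_sem _ law).
have cE K : (c%:E <= P (E K))%E.
  have [jo [jw wl]] := @within_launch R d (H K) i j ji rho m h K D (leq_maxl _ _).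
  apply: (le_trans _ (prob_le_sem (H K) d_gt0 law id wl)).
  by rewrite lee_fin; apply: hc; [exact: leq_maxl|exact: leq_maxr].
have [w [Qw Ew]] := ae_frequently c0 mE cE ae.
have reachE K : E K w -> om 0 w /\
    (fpt R om S 0 (target i rho K) w <= ((journey_time rho K + D)%:R)%:E)%E.
  move=> EK; have hl := @holds_launch R d (H K) i j ji rho m h K D (leq_maxl _ _)
    (leq_maxr _ _) Omega om S w.
  by have [b /= hb hQ] := sem_holds EK hl; exact: hQ.
have o0 : om 0 w by have [K _ /reachE[]] := Ew 0%N.
have := Qw o0 (delta_mx ord0 i); rewrite (map_delta_mx (intmul 1)) => cv.
(* The extra one in the distance is the shift of [gate]. *)
apply: (cvg_le_frequently (n := fun K => (reach_len rho K + side rho 0).+1) cv).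
  move=> K; have h1 := len_ge rho K; rewrite /reach_len.
  have rho0 : (0 < rho)%N by apply: leq_trans drho; rewrite muln_gt0 d_gt0.
  have h2 : (K < 8 ^ K)%N by exact: ltn_expl.
  have h3 : (8 ^ K <= 4 * rho * 8 ^ K)%N by rewrite leq_pmull // muln_gt0.
  move: h1 h2 h3; move: (len rho K) (side rho K) (8 ^ K)%N (4 * rho * _)%N => a b e f.
  by clear; lia.
move=> K0; have [K KK /reachE[_ fK]] := Ew K0; exists K => //.
set n := (_ + _).+1; rewrite /= -targetE.
have n0 : 0 < n%:R :> R by rewrite ltr0n.
rewrite lee_pdivrMr // -EFinM; apply: le_trans fK _.
rewrite lee_fin -!natrM ler_nat; apply: leq_trans (journey_time_le K drho) _.
rewrite leq_mul2l; apply/orP; right; rewrite /n /reach_len.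
by move: (len rho K) => a; clear; lia.
Qed.

End AxisBound.

Lemma norm_le_axes (R : realType) (d : nat) (mu : 'rV[R]_d -> R) (C : R) :
  is_norm mu -> (forall i, mu (delta_mx ord0 i) <= C) -> forall x, mu x <= C * l1r x.
Proof.
move=> [sub [hom _]] hC x.
have mu0 : mu 0 = 0 by rewrite -(scale0r 0) hom normr0 mul0r.
rewrite {1}(row_sum_delta x) /l1r mulr_sumr.
elim/big_ind2 : _ => [|y a z b ha hb|i _]; first by rewrite mu0.
  by apply: le_trans (sub _ _) _; exact: lerD.
by rewrite hom mulrC; apply: ler_wpM2r.
Qed.

Theorem theorem1p2 (R : realType) (d : nat) : (2 <= d)%N ->
  exists A2 : R, 0 < A2 /\
  exists r0 : R, 0 < r0 /\
  forall r : R, 0 < r -> r <= 1 -> r <= r0 ->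
  forall (dT : measure_display) (Omega : measurableType dT) (P : probability Omega R)
         (om : 'rV[int]_d -> Omega -> bool)
         (S : 'rV[int]_d -> nat -> Omega -> 'rV[int]_d),
  frog_law P r om S ->
  forall mu : 'rV[R]_d -> R, time_constant P om S mu ->
  forall x : 'rV[R]_d, mu x <= A2 * delta d r * l1r x.
Proof.
move=> d2; have d0 : (0 < d)%N by exact: leq_trans d2.
have [m [W [m0 W0] hW]] := @launch_constants R d d2.
have [A [A0 [r0 [r00 hA]]]] := @scale_exists R d W W0.
exists (2 * A); split; first by rewrite mulr_gt0.
exists r0; split=> // r r_gt0 r_le1 rr0 dT Omega P om S law mu tc.
have [rho [drho hrho rhoA]] := hA r r_gt0 r_le1 rr0.
have r01 : 0 <= r <= 1 by rewrite (ltW r_gt0).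
apply: norm_le_axes; first by case: tc.
move=> i; apply: (@le_trans _ _ (2 * rho%:R)); last by rewrite -mulrA; apply: ler_wpM2l.
(* The two lanes of a segment need a second axis, available since [d >= 2]. *)
have [j ji] : exists j : 'I_d, j != i.
  have [->|hi] := eqVneq i (Ordinal d0); first by exists (Ordinal d2).
  by exists (Ordinal d0); rewrite eq_sym.
have hp := hit_prob_gt0 R d.
apply: (axis_bound law tc d0 ji drho (c := r * (hit_prob R d / 4 * (2 * d)%:R^-1 ^+ (d * side rho 0)))).
- apply: mulr_gt0 r_gt0 _; apply: mulr_gt0; first by apply: divr_gt0 hp _.
  by rewrite exprn_gt0 // invr_gt0 ltr0n muln_gt0.
- by move=> K H KH DH; apply: hW.
Qed.
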